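(* Fix $\alpha>1$, let $M=T^2=\mathbb{C}^*/\mathbb{Z}$ and $N=S^3\times S^1=(\mathbb{C}^2\setminus\{0\})/\mathbb{Z}$ be the quotients by the actions generated by $z\mapsto\alpha z$ and $(z,w)\mapsto(\alpha z,\alpha w)$, with the Hermitian metrics $g$ and $h$ whose fundamental forms are $\frac{1}{2\rho^2}\sqrt{-1}\,\partial\bar\partial\rho^2$. Let $\mathcal F$ denote the family of all maps $f:T^2\to S^3\times S^1$ induced by $\mathbb{R}$-linear maps $\mathbb{R}^2\to\mathbb{R}^4$, $(x^1,x^2)\mapsto x^1u+x^2v$, where $(u,v)$ is an orthonormal pair of vectors in $\mathbb{R}^4$. Then the family $\mathcal F$ is preserved by the $\bar\partial$-harmonic map heat flow $\partial_tf=\tau_+(f)$ and, for any $f_0\in\mathcal F$, the flow starting at $f_0$ exists for all time and converges subsequentially (as $t\to\infty$) to a holomorphic or anti-holomorphic map $f_\infty:T^2\to S^3\times S^1$.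
   Context: On $\mathbb{C}^*$ and on $\mathbb{C}^2\setminus\{0\}$, $\rho$ denotes the Euclidean distance to $0$. The forms $\omega_M=\frac1{2\rho^2}\sqrt{-1}\,\partial\bar\partial\rho^2$ on $\mathbb{C}^*$ and $\omega_N=\frac1{2\rho^2}\sqrt{-1}\,\partial\bar\partial\rho^2$ on $\mathbb{C}^2\setminus\{0\}$ are invariant under scaling and descend to the quotients; the metrics are determined by $\omega_M(X,Y)=g(J_MX,Y)$ and $\omega_N(X,Y)=h(J_NX,Y)$, i.e. they are the Euclidean metrics multiplied by $\rho^{-2}$. Identify $\mathbb{C}\cong\mathbb{R}^2$ with coordinates $x^1,x^2$, and $\mathbb{C}^2\cong\mathbb{R}^4$ with the standard inner product and orthonormal basis $e_1,\dots,e_4$ with $Je_1=e_2$, $Je_3=e_4$. Linear maps commute with the scaling actions and hence descend to the quotients. For maps $f:M\to N$ set $E_+(f)=\frac14\int_M|Tf+J_N\,Tf\,J_M|^2dV_g$; its negative $L^2$-gradient is $\tau_+=\tau+A$, where $\tau=\mathrm{tr}_g\nabla Tf$ is the tension and, with Greek indices on $M$ and Roman indices on $N$, $2A^i=(\omega_M)_{\alpha\beta}f^j_\gamma f^k_\delta(d\omega_N)_{ljk}g^{\alpha\gamma}g^{\beta\delta}h^{li}$, $(d\omega)_{ijk}=\partial_k\omega_{ij}+\partial_j\omega_{ki}+\partial_i\omega_{jk}$ (the term involving $d^*\omega_M$ vanishes on a surface). Preserved means that the solution with initial condition in $\mathcal F$ stays in $\mathcal F$. $f$ is holomorphic if $J_N\,Tf=Tf\,J_M$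 and anti-holomorphic if $J_N\,Tf=-Tf\,J_M$. *)

(* Defs.v *)
From HB Require Import structures.
From mathcomp Require Import all_boot all_order all_algebra.
From mathcomp Require Import complex.
From mathcomp Require Import all_classical all_reals all_analysis.

Set Implicit Arguments.
Unset Strict Implicit.
Unset Printing Implicit Defensive.
Import Order.TTheory GRing.Theory Num.Theory.
Import numFieldNormedType.Exports.
Local Open Scope classical_set_scope.
Local Open Scope ring_scope.
Local Open Scope quotient_scope.

Section Smooth.
Variables (R : realType) (V W : normedModType R).

Definition iter_derive (vs : seq V) (F : V -> W) : V -> W :=
  foldr (fun v G => 'D_v G) F vs.

Definition smooth_on (U : set V) (F : V -> W) : Prop :=
  forall (vs : seq V) (x : V), U x ->
    (forall v : V, derivable (iter_derive vs F) x v) /\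
    {for x, continuous (iter_derive vs F)}.

End Smooth.

(* A tensor field is given by its components in the coordinates of [R^n];
   [christoffel g x k i j] is the Levi-Civita symbol with upper index [k]. *)
Section Coordinates.
Variable R : realType.

Definition pd (n : nat) (i : 'I_n) (phi : 'rV[R]_n -> R) (x : 'rV[R]_n) : R :=
  'D_(delta_mx 0 i) (phi : 'rV[R]_n -> R^o) x.

Definition christoffel (n : nat) (g : 'rV[R]_n -> 'M[R]_n) (x : 'rV[R]_n)
    (k i j : 'I_n) : R :=
  2^-1 * \sum_l invmx (g x) k l *
    (pd i (fun y => g y j l) x + pd j (fun y => g y i l) x
     - pd l (fun y => g y i j) x).

Definition dform (n : nat) (w : 'rV[R]_n -> 'M[R]_n) (x : 'rV[R]_n)
    (i j k : 'I_n) : R :=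
  pd k (fun y => w y i j) x + pd j (fun y => w y k i) x
  + pd i (fun y => w y j k) x.

Variables (m n : nat).
Variables (g wM : 'rV[R]_m -> 'M[R]_m) (h wN : 'rV[R]_n -> 'M[R]_n).
Variable F : 'rV[R]_m -> 'rV[R]_n.

Definition tension (x : 'rV[R]_m) : 'rV[R]_n :=
  \row_i \sum_a \sum_b invmx (g x) a b *
    (pd a (pd b (fun y => F y 0 i)) x
     - \sum_c christoffel g x c a b * pd c (fun y => F y 0 i) x
     + \sum_j \sum_k christoffel h (F x) i j k *
         pd a (fun y => F y 0 j) x * pd b (fun y => F y 0 k) x).

Definition torsion_term (x : 'rV[R]_m) : 'rV[R]_n :=
  \row_i (2^-1 *
    \sum_a \sum_b \sum_c \sum_d \sum_j \sum_k \sum_l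
      wM x a b * pd c (fun y => F y 0 j) x * pd d (fun y => F y 0 k) x *
      dform wN (F x) l j k *
      invmx (g x) a c * invmx (g x) b d * invmx (h (F x)) l i).

(* The term of [tau_+] containing [d^* omega_M] is absent: it vanishes when the
   domain is a surface, the only case in which [tau_plus] is used. *)
Definition tau_plus (x : 'rV[R]_m) : 'rV[R]_n := tension x + torsion_term x.

End Coordinates.

(* [C^m] as [R^(2m)]: with indices starting from [0], coordinates [2j] and
   [2j+1] are the real and imaginary parts of [z_j]. *)
Section ComplexSpace.
Variables (R : realType) (m : nat).
Implicit Types (x : 'rV[R]_(m.*2)) (j k : 'I_m).

Lemma re_idx_subproof j : (j.*2 < m.*2)%N.
Proof. by rewrite ltn_double. Qed.

Lemma im_idx_subproof j : (j.*2.+1 < m.*2)%N.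
Proof. by rewrite ltn_Sdouble. Qed.

Definition re_idx j : 'I_(m.*2) := Ordinal (re_idx_subproof j).
Definition im_idx j : 'I_(m.*2) := Ordinal (im_idx_subproof j).

(* Acts on row vectors from the right, so [J X] is [X *m Jmx]. *)
Definition Jmx : 'M[R]_(m.*2) :=
  \sum_j (delta_mx (re_idx j) (im_idx j) - delta_mx (im_idx j) (re_idx j)).

Definition dot (u v : 'rV[R]_(m.*2)) : R := \sum_i u 0 i * v 0 i.

Definition rho x : R := Num.sqrt (dot x x).

Definition zcoord j x : R[i] := Complex (x 0 (re_idx j)) (x 0 (im_idx j)).

Definition pdC (i : 'I_(m.*2)) (phi : 'rV[R]_(m.*2) -> R[i]) x : R[i] :=
  Complex (pd i (fun y => complex.Re (phi y)) x)
          (pd i (fun y => complex.Im (phi y)) x).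

Definition d_dz j (phi : 'rV[R]_(m.*2) -> R[i]) x : R[i] :=
  2^-1 * (pdC (re_idx j) phi x - 'i%C * pdC (im_idx j) phi x).

Definition d_dzbar j (phi : 'rV[R]_(m.*2) -> R[i]) x : R[i] :=
  2^-1 * (pdC (re_idx j) phi x + 'i%C * pdC (im_idx j) phi x).

(* [sqrt(-1) ddbar phi] at [x], evaluated on [X], [Y]; the wedge product is
   normalised by [(a /\ b)(X, Y) = a(X) b(Y) - a(Y) b(X)]. *)
Definition i_ddbar (phi : 'rV[R]_(m.*2) -> R[i]) x (X Y : 'rV[R]_(m.*2)) : R[i] :=
  'i%C * \sum_j \sum_k d_dz j (d_dzbar k phi) x *
    (zcoord j X * (zcoord k Y)^*%C - zcoord j Y * (zcoord k X)^*%C).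

(* [i_ddbar] of a real function is real, so taking the real part only changes
   the type. *)
Definition fund_form x : 'M[R]_(m.*2) :=
  \matrix_(i, j) ((2 * rho x ^+ 2)^-1 *
    complex.Re (i_ddbar (fun y => Complex (rho y ^+ 2) 0) x
                        (delta_mx 0 i) (delta_mx 0 j))).

(* [omega(X, Y) = g(J X, Y)] means [omega = J g], that is [g = - J omega]. *)
Definition hmetric x : 'M[R]_(m.*2) := - (Jmx *m fund_form x).

End ComplexSpace.

Section Hopf.
Variables (R : realType) (alpha : R) (m : nat).

Definition punctured : Type := {x : 'rV[R]_(m.*2) | x != 0}.
HB.instance Definition _ := Choice.on punctured.

Definition same_orbit : rel punctured :=
  fun x y => `[< exists k : int, val y = alpha ^ k *: val x >].

Lemma same_orbit_refl : reflexive same_orbit.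
Proof. by move=> x; apply/asboolP; exists 0; rewrite expr0z scale1r. Qed.

Lemma same_orbit_sym : symmetric same_orbit.
Proof.
suff H x y : same_orbit x y -> same_orbit y x.
  by move=> x y; apply/idP/idP; apply: H.
move=> /asboolP[k yE]; apply/asboolP; exists (- k).
have ak0 : alpha ^ k != 0.
  by apply: contraNneq (valP y) => ak0; rewrite yE ak0 scale0r.
by rewrite yE scalerA -invr_expz mulVf // scale1r.
Qed.

Lemma same_orbit_trans : transitive same_orbit.
Proof.
move=> y x z /asboolP[k yE] /asboolP[l zE]; apply/asboolP.
have [a0|a0] := eqVneq alpha 0.
  exists l; rewrite zE yE a0 exp0rz.
  have [->|k0] := eqVneq k 0; first by rewrite scale1r.
  by have := valP y; rewrite yE a0 exp0rz (negbTE k0) scale0r eqxx.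
by exists (l + k); rewrite zE yE scalerA expfzDr.
Qed.

Canonical same_orbit_equiv :=
  EquivRel same_orbit same_orbit_refl same_orbit_sym same_orbit_trans.

Definition hopf : Type := {eq_quot same_orbit_equiv}.

Definition hopf_pi (x : 'rV[R]_(m.*2)) (hx : x != 0) : hopf :=
  \pi_({eq_quot same_orbit_equiv}) (exist _ x hx : punctured).

End Hopf.

(* The projection [C^m \ {0} -> hopf alpha m] is a covering and, by
   definition of the structures on the quotient, a local holomorphic isometry.
   Local notions are therefore expressed through local lifts to the
   coverings. *)
Section Maps.
Variables (R : realType) (alpha : R).

Section General.
Variables (m n : nat).
Implicit Types (f : hopf alpha m -> hopf alpha n)
  (F : 'rV[R]_(m.*2) -> 'rV[R]_(n.*2)).

Definition lifts_at f F (z : 'rV[R]_(m.*2)) : Prop :=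
  exists (hz : z != 0) (hF : F z != 0),
    f (hopf_pi alpha hz) = hopf_pi alpha hF.

Definition smooth_lift_on (U : set 'rV[R]_(m.*2)) f F : Prop :=
  smooth_on U F /\ forall z, U z -> lifts_at f F z.

Definition holomorphic_map f : Prop :=
  forall z0 : 'rV[R]_(m.*2), z0 != 0 ->
    exists (U : set 'rV[R]_(m.*2)) F,
      [/\ open U, U z0, smooth_lift_on U f F
        & forall z X, U z -> 'D_X F z *m Jmx R n = 'D_(X *m Jmx R m) F z].

Definition antiholomorphic_map f : Prop :=
  forall z0 : 'rV[R]_(m.*2), z0 != 0 ->
    exists (U : set 'rV[R]_(m.*2)) F,
      [/\ open U, U z0, smooth_lift_on U f F
        & forall z X, U z -> 'D_X F z *m Jmx R n = - 'D_(X *m Jmx R m) F z].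

(* [C^oo] convergence, the domain being compact. *)
Definition smooth_cvg (fs : nat -> hopf alpha m -> hopf alpha n) f : Prop :=
  forall z0 : 'rV[R]_(m.*2), z0 != 0 ->
    exists (U : set 'rV[R]_(m.*2))
        (Fs : nat -> 'rV[R]_(m.*2) -> 'rV[R]_(n.*2)) F,
      [/\ open U, U z0, smooth_lift_on U f F,
          \forall k \near \oo, smooth_lift_on U (fs k) (Fs k)
        & forall vs : seq 'rV[R]_(m.*2),
            {uniform U, (fun k => iter_derive vs (Fs k)) @ \oo
                        --> iter_derive vs F}].

End General.

Definition torus : Type := hopf alpha 1.
Definition hopf_surface : Type := hopf alpha 2.

(* A smooth solution on [0, T[ of the flow. Smoothness up to the initial time
   means that the local lifts extend smoothly to negative times, so that at
   [t = 0] the derivative ['D_(1, 0)] is the one-sided one. *)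
Definition dbar_flow (T : \bar R) (f : R -> torus -> hopf_surface) : Prop :=
  forall (t0 : R) (z0 : 'rV[R]_(1.*2)), 0 <= t0 -> (t0%:E < T)%E -> z0 != 0 ->
    exists (U : set (R^o * 'rV[R]_(1.*2))%type)
        (F : (R^o * 'rV[R]_(1.*2))%type -> 'rV[R]_(2.*2)),
      [/\ open U, U (t0, z0), smooth_on U F
        & forall (t : R) z, U (t, z) -> 0 <= t -> (t%:E < T)%E ->
            lifts_at (f t) (fun y => F (t, y)) z /\
            'D_(1, 0) F (t, z) =
              tau_plus (@hmetric R 1) (@fund_form R 1)
                       (@hmetric R 2) (@fund_form R 2) (fun y => F (t, y)) z].

Definition orthonormal_family (f : torus -> hopf_surface) : Prop :=
  exists u v : 'rV[R]_(2.*2),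
    [/\ dot u u = 1, dot v v = 1, dot u v = 0
      & forall z : 'rV[R]_(1.*2), z != 0 ->
          lifts_at f
            (fun x => x 0 (re_idx ord0) *: u + x 0 (im_idx ord0) *: v) z].

End Maps.

(* Main.v *)
Require Import Defs.
From mathcomp Require Import all_boot all_order all_algebra.
From mathcomp Require Import complex ring lra.
From mathcomp Require Import all_classical all_reals all_analysis.
Import Order.TTheory GRing.Theory Num.Theory.
Import numFieldNormedType.Exports.
Set Implicit Arguments.
Unset Strict Implicit.
Unset Printing Implicit Defensive.
Local Open Scope classical_set_scope.
Local Open Scope ring_scope.

(* In logarithmic coordinates on the torus and in the polar form
   [y = exp r * sigma] of a lift to [C^2 \ {0}], the flow reads
     r_t     = |z|^2 (Lap r - 2 <J sigma_1, sigma_2>),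
     sigma_t = |z|^2 (Lap sigma + |grad sigma|^2 sigma
                      + 2 (W - <W, sigma> sigma)),
   with [W = r_2 J sigma_1 - r_1 J sigma_2].  On the map induced by
   [x^1 u + x^2 v] with [(u, v)] orthonormal the tension vanishes and the flow
   becomes the ODE [u' = -2 (J v + a u)], [v' = 2 (J u - a v)],
   [a = <J u, v>].  Its solution rescales the complex linear part of the
   initial map by [A(t)] and the antilinear part by [B(t)], where
   [A / B = exp (4 t)]; hence one of the two parts is absent in the limit.

   That every solution starting in the family is this explicit one follows from
   the maximum principle.  For two solutions [(r, sigma)] and [(R, S)], the
   function [gap = 1 - <sigma, S> + kappa^-2 (1 - cos (kappa (r - R)))], with
   [kappa = 2 pi / ln alpha], is well defined on the quotients and vanishes only
   where the solutions agree.  Where it is small, the good terms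
   [- |grad (sigma - S)|^2 - |grad (r - R)|^2 / 2] absorb all quadratic terms in
   the differences, so that [gap_t <= |z|^2 Lap gap + 280 gap] with a constant
   depending only on the gradient of the explicit solution. *)

(** * Linear algebra *)

(** Preservation and convergence are asserted for every solution, hence the need for uniqueness. The
    obstacle is that an arbitrary solution has only local lifts, each determined up to a power of
    [alpha]: two solutions can be compared only through a function invariant under such shifts in
    each argument separately. This is why a cosine of period ln alpha replaces (r - R)^2 / 2,
    whereas 1 - <sigma, S> is just |sigma - S|^2 / 2.

    The inequality for gap holds only where gap is small. It is therefore played against a barrier
    eta exp (300 t), which grows faster than the rate 280 and stays small up to a given time if eta
    is small. On a compact fundamental domain there would be a first contact, where the two rates
    contradict each other; choosing eta according to a hypothetical positive value of gap shows that
    gap vanishes.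

    As for A and B: with p, q the linear and antilinear parts, the ODE reads A' = (2 - 2a) A, B' =
    (- 2 - 2a) B, where a = |p|^2 A^2 - |q|^2 B^2. So A / B is known, and |p|^2 A^2 + |q|^2 B^2 = 1
    determines both. *)

Lemma half_idx_subproof m (i : 'I_(m.*2)) : (i./2 < m)%N.
Proof. by rewrite ltn_half_double. Qed.

Lemma sum_re_im (V : nmodType) m (f : 'I_(m.*2) -> V) :
  \sum_i f i = \sum_j (f (re_idx j) + f (im_idx j)).
Proof.
pose hf i := Ordinal (@half_idx_subproof m i).
rewrite big_split /= (bigID (fun i : 'I__ => ~~ odd i)) /=; congr +%R.
  rewrite (reindex_onto (@re_idx m) hf) /= => [|i /negbTE ei].
    by apply: eq_bigl => j; rewrite odd_double -val_eqE /= doubleK eqxx.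
  by apply: val_inj; rewrite /= -{2}(odd_double_half i) ei.
rewrite (reindex_onto (@im_idx m) hf) /= => [|i /negbNE ei].
  by apply: eq_bigl => j; rewrite odd_double -val_eqE /= uphalf_double eqxx.
by apply: val_inj; rewrite /= -{2}(odd_double_half i) ei.
Qed.

Section DotAlgebra.
Variables (R : realType) (m : nat).
Implicit Types (u v w : 'rV[R]_(m.*2)).

Lemma dotC u v : dot u v = dot v u.
Proof. by apply: eq_bigr => i _; rewrite mulrC. Qed.
Lemma dotDl u v w : dot (u + v) w = dot u w + dot v w.
Proof. by rewrite /dot -big_split; apply: eq_bigr => i _; rewrite mxE mulrDl. Qed.
Lemma dotZl a u v : dot (a *: u) v = a * dot u v.
Proof. by rewrite /dot mulr_sumr; apply: eq_bigr => i _; rewrite mxE mulrA. Qed.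
Lemma dotDr u v w : dot w (u + v) = dot w u + dot w v.
Proof. by rewrite !(dotC w) dotDl. Qed.
Lemma dotZr a u v : dot u (a *: v) = a * dot u v.
Proof. by rewrite !(dotC u) dotZl. Qed.
Lemma dotNl u v : dot (- u) v = - dot u v.
Proof. by rewrite -scaleN1r dotZl mulN1r. Qed.
Lemma dotNr u v : dot u (- v) = - dot u v.
Proof. by rewrite !(dotC u) dotNl. Qed.
Lemma dotBl u v w : dot (u - v) w = dot u w - dot v w.
Proof. by rewrite dotDl dotNl. Qed.
Lemma dotBr u v w : dot w (u - v) = dot w u - dot w v.
Proof. by rewrite dotDr dotNr. Qed.
Lemma dot0l u : dot 0 u = 0.
Proof. by rewrite -(scale0r u) dotZl mul0r. Qed.

Definition dotE := (dotDl, dotDr, dotBl, dotBr, dotNl, dotNr, dotZl, dotZr).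

Lemma dot_ge0 u : 0 <= dot u u.
Proof. by apply: sumr_ge0 => i _; rewrite -expr2 sqr_ge0. Qed.

Lemma dot_eq0 u : (dot u u == 0) = (u == 0).
Proof.
apply/eqP/eqP => [|->]; last by rewrite dot0l.
move=> /eqP; rewrite psumr_eq0 => [/allP h|i _]; last by rewrite -expr2 sqr_ge0.
apply/rowP => i; have := h i (mem_index_enum _).
by rewrite mulf_eq0 orbb mxE => /eqP.
Qed.

Lemma dot_gt0 u : (0 < dot u u) = (u != 0).
Proof. by rewrite lt_def dot_ge0 andbT dot_eq0. Qed.

Lemma cauchy_schwarz u v : dot u v ^+ 2 <= dot u u * dot v v.
Proof.
have [->|v0] := eqVneq v 0; first by rewrite dotC !dot0l expr0n mulr0.
have := dot_ge0 (dot v v *: u - dot u v *: v).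
rewrite !dotE (dotC v u) [X in _ <= X](_ : _ =
  dot v v * (dot u u * dot v v - dot u v ^+ 2)); last by ring.
by rewrite pmulr_rge0 ?dot_gt0 // subr_ge0.
Qed.

Lemma dot_le u v (a b : R) : 0 <= a -> 0 <= b -> dot u u <= a ^+ 2 ->
  dot v v <= b ^+ 2 -> `|dot u v| <= a * b.
Proof.
move=> a0 b0 ua vb; rewrite -(ler_pXn2r (_ : 0 < 2)%N) ?nnegrE ?mulr_ge0 //.
rewrite real_normK ?num_real // (le_trans (cauchy_schwarz u v)) // exprMn.
by rewrite ler_pM ?dot_ge0.
Qed.
End DotAlgebra.

Section ComplexStructure.
Variables (R : realType) (m : nat).
Implicit Types (u v w : 'rV[R]_(m.*2)) (j k : 'I_m).
Local Notation J := (Jmx R m).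

Lemma re_idx_inj : injective (@re_idx m).
Proof. by move=> j k /(congr1 val) /= /double_inj /val_inj. Qed.

Lemma im_idx_inj : injective (@im_idx m).
Proof. by move=> j k /(congr1 val) /= [] /double_inj /val_inj. Qed.

Lemma re_im_idx j k : (re_idx j == im_idx k) = false.
Proof.
apply/eqP => /(congr1 val) /= /(congr1 odd).
by rewrite /= !odd_double.
Qed.

Lemma im_re_idx j k : (im_idx j == re_idx k) = false.
Proof. by rewrite eq_sym re_im_idx. Qed.

Definition idxE := (re_im_idx, im_re_idx, inj_eq re_idx_inj, inj_eq im_idx_inj).

Lemma re_im_ind (P : 'I_(m.*2) -> Prop) :
  (forall j, P (re_idx j)) -> (forall j, P (im_idx j)) -> forall i, P i.
Proof.
move=> hr hi i; have := odd_double_half i; case: (boolP (odd i)) => _ e.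
  suff -> : i = im_idx (Ordinal (half_idx_subproof i)) by [].
  exact: val_inj.
suff -> : i = re_idx (Ordinal (half_idx_subproof i)) by [].
exact: val_inj.
Qed.

Lemma Jmx_rr j k : J (re_idx j) (re_idx k) = 0.
Proof.
rewrite summxE big1 // => l _.
by rewrite !mxE !idxE !andbF !andFb subrr.
Qed.

Lemma Jmx_ii j k : J (im_idx j) (im_idx k) = 0.
Proof.
rewrite summxE big1 // => l _.
by rewrite !mxE !idxE !andbF !andFb subrr.
Qed.

Lemma Jmx_ri j k : J (re_idx j) (im_idx k) = (j == k)%:R.
Proof.
rewrite summxE (bigD1 j) //= big1 => [|l lj]; rewrite !mxE !idxE !andFb subr0.
  by rewrite eqxx addr0 [k == j]eq_sym.
by rewrite eq_sym (negbTE lj).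
Qed.

Lemma Jmx_ir j k : J (im_idx j) (re_idx k) = - (j == k)%:R.
Proof.
rewrite summxE (bigD1 j) //= big1 => [|l lj]; rewrite !mxE !idxE !andFb sub0r.
  by rewrite eqxx addr0 [k == j]eq_sym.
by rewrite eq_sym (negbTE lj) oppr0.
Qed.

Definition JmxE := (Jmx_rr, Jmx_ii, Jmx_ri, Jmx_ir).

Lemma mulmx_J_re u j : (u *m J) 0 (re_idx j) = - u 0 (im_idx j).
Proof.
rewrite mxE sum_re_im (bigD1 j) //= big1 => [|k kj].
  by rewrite !JmxE eqxx mulr0 mulrN1 add0r addr0.
by rewrite !JmxE (negbTE kj) oppr0 !mulr0 addr0.
Qed.

Lemma mulmx_J_im u j : (u *m J) 0 (im_idx j) = u 0 (re_idx j).
Proof.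
rewrite mxE sum_re_im (bigD1 j) //= big1 => [|k kj].
  by rewrite !JmxE eqxx mulr0 mulr1 !addr0.
by rewrite !JmxE (negbTE kj) !mulr0 addr0.
Qed.

Lemma mulmx_JJ u : u *m J *m J = - u.
Proof.
by apply/rowP; apply: re_im_ind => j;
  rewrite ?mulmx_J_re ?mulmx_J_im ?mulmx_J_re !mxE.
Qed.

Lemma dot_J u v : dot (u *m J) v = - dot u (v *m J).
Proof.
rewrite /dot !sum_re_im -sumrN; apply: eq_bigr => j _.
by rewrite !mulmx_J_re !mulmx_J_im; ring.
Qed.

Lemma dot_JJ u v : dot (u *m J) (v *m J) = dot u v.
Proof. by rewrite dot_J mulmx_JJ dotNr opprK. Qed.

Lemma dot_J_id u : dot (u *m J) u = 0.
Proof. by have := dot_J u u; rewrite (dotC u) => h; lra. Qed.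
End ComplexStructure.

(** * The differential inequality behind uniqueness *)

Section MaximumPrincipleEstimate.
Variables (R : realType) (m : nat).
Implicit Types (s d : 'rV[R]_(m.*2)).
Local Notation J := (Jmx R m).

(** The vector W of the equation for sigma, with [s1], [s2] the derivatives of sigma and [r1], [r2]
    those of r. *)
Definition twist (s1 s2 : 'rV[R]_(m.*2)) (r1 r2 : R) :=
  r2 *: (s1 *m J) - r1 *: (s2 *m J).

(** The right-hand side of the equation for sigma without the Laplacian and the factor |z|^2. *)
Definition sphere_term s (s1 s2 : 'rV[R]_(m.*2)) (r1 r2 : R) :=
  (dot s1 s1 + dot s2 s2) *: s
  + 2 *: (twist s1 s2 r1 r2 - dot (twist s1 s2 r1 r2) s *: s).

(** Here D, p, q are the sizes of s - S, of its gradient and of the gradient of r - R. Each mixed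
    product is split by a weighted arithmetic-geometric mean inequality, with weights such that the
    coefficients of p^2 and q^2 stay negative. Those of D^2 then add up to 137 and that of mu^2 is
    64, whence 140. *)
Lemma absorb_cross_terms (D p q mu : R) : 0 <= D -> 0 <= p -> 0 <= q -> 0 <= mu ->
  D <= 20^-1 -> mu <= 20^-1 ->
  - p ^+ 2 + D ^+ 2 * ((1 + p) ^+ 2 + 1) + 4 * D * (q + q * p + p)
  + D ^+ 2 * (2 * (1 + q) * (1 + p) + 2) - 2^-1 * q ^+ 2
  + 2 * mu * (2 * p + p ^+ 2) <= 140 * (D ^+ 2 + mu ^+ 2).
Proof.
move=> D0 p0 q0 m0 D1 m1.
have D2 : D ^+ 2 <= 400^-1 by nra.
have Dp2 : D ^+ 2 * p ^+ 2 <= 400^-1 * p ^+ 2 by rewrite ler_wpM2r ?sqr_ge0.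
have Dq2 : D ^+ 2 * q ^+ 2 <= 400^-1 * q ^+ 2 by rewrite ler_wpM2r ?sqr_ge0.
have h1 : D ^+ 2 * (1 + p) ^+ 2 <= D ^+ 2 * (2 + 2 * p ^+ 2).
  by rewrite ler_wpM2l ?sqr_ge0 //; have := sqr_ge0 (1 - p); nra.
have h2 : 4 * D * q <= 64 * D ^+ 2 + 16^-1 * q ^+ 2.
  by have := sqr_ge0 (8 * D - 4^-1 * q); nra.
have h3 : 4 * D * p <= 64 * D ^+ 2 + 16^-1 * p ^+ 2.
  by have := sqr_ge0 (8 * D - 4^-1 * p); nra.
have h4 : 4 * D * (q * p) <= 10^-1 * (q ^+ 2 + p ^+ 2).
  have : D * (q * p) <= 20^-1 * (q * p) by rewrite ler_wpM2r ?mulr_ge0.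
  by have := sqr_ge0 (q - p); nra.
have h5 : D ^+ 2 * (2 * (1 + q) * (1 + p)) <= D ^+ 2 * (4 + 2 * q ^+ 2 + 2 * p ^+ 2).
  rewrite ler_wpM2l ?sqr_ge0 //.
  by have := sqr_ge0 (1 - p); have := sqr_ge0 (1 - q); have := sqr_ge0 (q - p); nra.
have h6 : 4 * mu * p <= 64 * mu ^+ 2 + 16^-1 * p ^+ 2.
  by have := sqr_ge0 (8 * mu - 4^-1 * p); nra.
have h7 : mu * p ^+ 2 <= 20^-1 * p ^+ 2 by rewrite ler_wpM2r ?sqr_ge0.
have := sqr_ge0 p; have := sqr_ge0 q; have := sqr_ge0 D; have := sqr_ge0 mu.
lra.
Qed.

(* Up to the factor [|z|^2], the left-hand side is [gap_t - |z|^2 Lap gap].  No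
   bound is needed on the derivatives of [(s, r)], which are controlled by those
   of [(S, R)] and by the good terms. *)
Lemma comparison_estimate (s S s1 s2 S1 S2 : 'rV[R]_(m.*2))
    (r1 r2 R1 R2 cs mu : R) :
  dot s s = 1 -> dot S S = 1 ->
  dot S1 S1 <= 1 -> dot S2 S2 <= 1 -> R1 ^+ 2 <= 1 -> R2 ^+ 2 <= 1 ->
  2^-1 <= cs -> 2 * (1 - dot s S) <= 400^-1 -> mu ^+ 2 <= 400^-1 ->
  - dot (sphere_term s s1 s2 r1 r2) S - dot s (sphere_term S S1 S2 R1 R2)
  + 2 * (dot s1 S1 + dot s2 S2)
  - cs * ((r1 - R1) ^+ 2 + (r2 - R2) ^+ 2)
  - 2 * mu * (dot (s1 *m J) s2 - dot (S1 *m J) S2)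
  <= 140 * (2 * (1 - dot s S) + mu ^+ 2).
Proof.
move=> ss SS S11 S22 R11 R22 hcs hD hmu.
set d := s - S; set d1 := s1 - S1; set d2 := s2 - S2.
set a1 := r1 - R1; set a2 := r2 - R2.
pose D := Num.sqrt (dot d d); pose p := Num.sqrt (dot d1 d1 + dot d2 d2).
pose q := Num.sqrt (a1 ^+ 2 + a2 ^+ 2).
have D0 : 0 <= D by exact: sqrtr_ge0.
have p0 : 0 <= p by exact: sqrtr_ge0.
have q0 : 0 <= q by exact: sqrtr_ge0.
have D2 : D ^+ 2 = dot d d by rewrite sqr_sqrtr ?dot_ge0.
have p2 : p ^+ 2 = dot d1 d1 + dot d2 d2 by rewrite sqr_sqrtr ?addr_ge0 ?dot_ge0.
have q2 : q ^+ 2 = a1 ^+ 2 + a2 ^+ 2 by rewrite sqr_sqrtr ?addr_ge0 ?sqr_ge0.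
have De : dot d d = 2 * (1 - dot s S).
  by rewrite /d !dotE ss SS (dotC S s); ring.
have D1 : D <= 20^-1.
  rewrite -(ler_pXn2r (_ : 0 < 2)%N) ?nnegrE //; rewrite D2 De.
  by apply: le_trans hD _; rewrite exprVn; lra.
have mu1 : `|mu| <= 20^-1.
  rewrite -(ler_pXn2r (_ : 0 < 2)%N) ?nnegrE //; rewrite real_normK ?num_real //.
  by apply: le_trans hmu _; rewrite exprVn; lra.
have bd : dot d d <= D ^+ 2 by rewrite D2.
have bd1 : dot d1 d1 <= p ^+ 2 by rewrite p2 lerDl dot_ge0.
have bd2 : dot d2 d2 <= p ^+ 2 by rewrite p2 lerDr dot_ge0.
have ba1 : `|a1| <= q.
  by rewrite -(ler_pXn2r (_ : 0 < 2)%N) ?nnegrE // real_normK ?num_real // q2 lerDl sqr_ge0.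
have ba2 : `|a2| <= q.
  by rewrite -(ler_pXn2r (_ : 0 < 2)%N) ?nnegrE // real_normK ?num_real // q2 lerDr sqr_ge0.
have bR1 : `|R1| <= 1.
  by rewrite -(ler_pXn2r (_ : 0 < 2)%N) ?nnegrE // real_normK ?num_real // expr1n.
have bR2 : `|R2| <= 1.
  by rewrite -(ler_pXn2r (_ : 0 < 2)%N) ?nnegrE // real_normK ?num_real // expr1n.
have br1 : `|r1| <= 1 + q.
  by rewrite -(subrK R1 r1) (le_trans (ler_normD _ _)) // addrC lerD.
have br2 : `|r2| <= 1 + q.
  by rewrite -(subrK R2 r2) (le_trans (ler_normD _ _)) // addrC lerD.
have one : (1 : R) = 1 ^+ 2 by rewrite expr1n.
have bS1 : dot S1 S1 <= 1 ^+ 2 by rewrite -one.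
have bS2 : dot S2 S2 <= 1 ^+ 2 by rewrite -one.
have bs0 : dot s s <= 1 ^+ 2 by rewrite -one ss.
have bS0 : dot S S <= 1 ^+ 2 by rewrite -one SS.
have bs1 : dot s1 s1 <= (1 + p) ^+ 2.
  have -> : dot s1 s1 = dot S1 S1 + 2 * dot S1 d1 + dot d1 d1.
    by rewrite /d1 !dotE (dotC s1 S1); ring.
  have := ler_norm (dot S1 d1); have := dot_le ler01 p0 bS1 bd1.
  by rewrite sqrrD expr1n; lra.
have bs2 : dot s2 s2 <= (1 + p) ^+ 2.
  have -> : dot s2 s2 = dot S2 S2 + 2 * dot S2 d2 + dot d2 d2.
    by rewrite /d2 !dotE (dotC s2 S2); ring.
  have := ler_norm (dot S2 d2); have := dot_le ler01 p0 bS2 bd2.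
  by rewrite sqrrD expr1n; lra.
have J_le (u v : 'rV[R]_(m.*2)) (a b : R) : 0 <= a -> 0 <= b -> dot u u <= a ^+ 2 ->
    dot v v <= b ^+ 2 -> `|dot (u *m J) v| <= a * b.
  by move=> *; apply: dot_le; rewrite ?dot_JJ.
have prod_le (x y a b : R) : `|x| <= a -> `|y| <= b -> `|x * y| <= a * b.
  by move=> *; rewrite normrM ler_pM.
set W := twist s1 s2 r1 r2; set W' := twist S1 S2 R1 R2.
(* Writing s_i = S_i + d_i and r_i = R_i + a_i, every term contains d and one of the differences
   a_i, d_i; the remaining factors S_i, R_i are at most 1. *)
have t1 : `|dot (W - W') d| <= 2 * D * (q + q * p + p).
  have -> : dot (W - W') d =
      a2 * dot (S1 *m J) d + a2 * dot (d1 *m J) d + R2 * dot (d1 *m J) d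
      - (a1 * dot (S2 *m J) d + a1 * dot (d2 *m J) d + R1 * dot (d2 *m J) d).
    rewrite /W /W' /twist /d1 /d2 /a1 /a2 !mulmxBl.
    by rewrite ?(dotBl, dotZl); ring.
  have := prod_le _ _ _ _ ba2 (J_le _ _ _ _ ler01 D0 bS1 bd).
  have := prod_le _ _ _ _ ba2 (J_le _ _ _ _ p0 D0 bd1 bd).
  have := prod_le _ _ _ _ bR2 (J_le _ _ _ _ p0 D0 bd1 bd).
  have := prod_le _ _ _ _ ba1 (J_le _ _ _ _ ler01 D0 bS2 bd).
  have := prod_le _ _ _ _ ba1 (J_le _ _ _ _ p0 D0 bd2 bd).
  have := prod_le _ _ _ _ bR1 (J_le _ _ _ _ p0 D0 bd2 bd).
  by rewrite !ler_norml; lra.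
have t2 : `|dot W s| <= 2 * (1 + q) * (1 + p).
  have p1 : 0 <= 1 + p by rewrite addr_ge0.
  have := prod_le _ _ _ _ br2 (J_le _ _ _ _ p1 ler01 bs1 bs0).
  have := prod_le _ _ _ _ br1 (J_le _ _ _ _ p1 ler01 bs2 bs0).
  by rewrite /W /twist !dotE !ler_norml; lra.
have t3 : `|dot W' S| <= 2.
  have := prod_le _ _ _ _ bR2 (J_le _ _ _ _ ler01 ler01 bS1 bS0).
  have := prod_le _ _ _ _ bR1 (J_le _ _ _ _ ler01 ler01 bS2 bS0).
  by rewrite /W' /twist !dotE !ler_norml; lra.
have t4 : `|mu * (dot (s1 *m J) s2 - dot (S1 *m J) S2)|
    <= `|mu| * (2 * p + p ^+ 2).
  apply: prod_le => //.
  have -> : dot (s1 *m J) s2 - dot (S1 *m J) S2 =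
      dot (d1 *m J) S2 + dot (S1 *m J) d2 + dot (d1 *m J) d2.
    by rewrite /d1 /d2 !mulmxBl !dotE; ring.
  have := J_le _ _ _ _ p0 ler01 bd1 bS2; have := J_le _ _ _ _ ler01 p0 bS1 bd2.
  have := J_le _ _ _ _ p0 p0 bd1 bd2.
  by rewrite !ler_norml expr2; lra.
set e := 1 - dot s S.
(* Since <s, S> = 1 - e, the terms |grad sigma|^2 sigma and the products <s_i, S_i> complete the
   square - p^2 up to a multiple of e, and the projections in [sphere_term] turn W and W' into <W -
   W', d> up to a multiple of e. *)
have -> : - dot (sphere_term s s1 s2 r1 r2) S - dot s (sphere_term S S1 S2 R1 R2)
    + 2 * (dot s1 S1 + dot s2 S2) =
    - p ^+ 2 + e * (dot s1 s1 + dot s2 s2 + dot S1 S1 + dot S2 S2)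
    + 2 * dot (W - W') d - 2 * e * (dot W s + dot W' S).
  rewrite p2 /sphere_term /W /W' /twist /d1 /d2 /d /e.
  rewrite ?(dotDl, dotDr, dotBl, dotBr, dotNl, dotNr, dotZl, dotZr).
  rewrite (dotC s1 S1) (dotC s2 S2) (dotC s (S1 *m J)) (dotC s (S2 *m J)).
  by ring.
have e0 : 0 <= e by have := dot_ge0 d; rewrite De -/e; lra.
have eD : e = D ^+ 2 / 2 by rewrite D2 De -/e; field.
have E1 : e * (dot s1 s1 + dot s2 s2 + dot S1 S1 + dot S2 S2)
    <= e * (2 * (1 + p) ^+ 2 + 2).
  by rewrite ler_wpM2l //; lra.
have E2 : - (2 * e * (dot W s + dot W' S)) <= 2 * e * (2 * (1 + q) * (1 + p) + 2).
  rewrite -mulrN ler_wpM2l ?mulr_ge0 //.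
  by move: t2 t3; rewrite !ler_norml; lra.
have E3 : - (cs * (a1 ^+ 2 + a2 ^+ 2)) <= - (2^-1 * q ^+ 2).
  by rewrite lerN2 -q2 ler_wpM2r ?sqr_ge0.
have := absorb_cross_terms D0 p0 q0 (normr_ge0 mu) D1 mu1.
rewrite real_normK ?num_real //.
have -> : 2 * e = D ^+ 2 by rewrite eD; field.
move: t1 t4 E1 E2 E3; rewrite !ler_norml eD /a1 /a2; lra.
Qed.
End MaximumPrincipleEstimate.

(** * The flow equation in coordinates *)

Section Metrics.
Variables (R : realType).

Lemma is_derive_coord n (x v : 'rV[R]_n) k :
  is_derive x v (fun y : 'rV[R]_n => y 0 k) (v 0 k).
Proof.
have hid : derivable (@id 'rV[R]_n) x v by exact: derivable_id.
apply: DeriveDef; first by have /derivable_mxP := hid; apply.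
have := derive_mx hid; rewrite derive_id => /matrixP /(_ 0 k).
by rewrite mxE => ->.
Qed.

Lemma is_derive_dot m (x v : 'rV[R]_(m.*2)) :
  is_derive x v (fun y : 'rV[R]_(m.*2) => dot y y) (2 * dot x v).
Proof.
have -> : (fun y : 'rV[R]_(m.*2) => dot y y) =
    \sum_k ((fun y : 'rV[R]_(m.*2) => y 0 k) * (fun y => y 0 k)).
  by apply/funext => y; rewrite fct_sumE.
apply: is_derive_eq (is_derive_sum (fun k => is_deriveM
  (is_derive_coord x v k) (is_derive_coord x v k))) _.
by rewrite /dot mulr_sumr; apply: eq_bigr => k _; rewrite /GRing.scale /=; ring.
Qed.

Lemma dot_delta m (x : 'rV[R]_(m.*2)) i : dot x (delta_mx 0 i) = x 0 i.
Proof.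
rewrite /dot (bigD1 i) //= big1 => [|j ji]; rewrite !mxE ?eqxx ?mulr1 ?addr0 //.
by rewrite (negbTE ji) andbF mulr0.
Qed.

Lemma pd_coord n (x : 'rV[R]_n) i k :
  pd i (fun y : 'rV[R]_n => y 0 k) x = (k == i)%:R.
Proof. by rewrite /pd (@derive_val _ _ _ _ _ _ _ (is_derive_coord _ _ _)) mxE. Qed.

Lemma pd_dot m (x : 'rV[R]_(m.*2)) i :
  pd i (fun y : 'rV[R]_(m.*2) => dot y y) x = 2 * x 0 i.
Proof. by rewrite /pd (@derive_val _ _ _ _ _ _ _ (is_derive_dot _ _)) dot_delta. Qed.

Lemma pd_dotV m (x : 'rV[R]_(m.*2)) i a : x != 0 ->
  pd i (fun y : 'rV[R]_(m.*2) => a * (dot y y)^-1) x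
  = - (2 * a * x 0 i / dot x x ^+ 2).
Proof.
move=> x0; have nz : dot x x != 0 by rewrite dot_eq0.
have dd : derivable (fun y : 'rV[R]_(m.*2) => dot y y) x (delta_mx 0 i).
  by have [] := is_derive_dot x (delta_mx 0 i).
have dV := @derivableV _ _ (fun y : 'rV[R]_(m.*2) => dot y y) x _ nz dd.
rewrite /pd [LHS](deriveZ a dV).
rewrite (@deriveV _ _ (fun y : 'rV[R]_(m.*2) => dot y y) x _ nz dd).
rewrite (@derive_val _ _ _ _ _ _ _ (is_derive_dot _ _)) dot_delta.
by rewrite /GRing.scale /=; field.
Qed.

Lemma rho2 m (x : 'rV[R]_(m.*2)) : rho x ^+ 2 = dot x x.
Proof. by rewrite /rho sqr_sqrtr // dot_ge0. Qed.

Lemma pd0 n (x : 'rV[R]_n) i : pd i (fun=> 0) x = 0.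
Proof. exact: derive_cst. Qed.

Lemma d_dzbar_rho2 m k :
  d_dzbar k (fun y : 'rV[R]_(m.*2) => Complex (rho y ^+ 2) 0) = @zcoord R m k.
Proof.
apply/funext => x; rewrite /d_dzbar /pdC /=.
have -> : (fun y : 'rV[R]_(m.*2) => rho y ^+ 2) = (fun y => dot y y).
  by apply/funext => y; rewrite rho2.
rewrite !pd_dot !pd0 /zcoord; apply/eqP; rewrite eq_complex /=.
by apply/andP; split; apply/eqP; simpc; field.
Qed.

Lemma d_dz_zcoord m j k (x : 'rV[R]_(m.*2)) :
  d_dz j (@zcoord R m k) x = (j == k)%:R.
Proof.
rewrite /d_dz /pdC /= !pd_coord !idxE eq_sym.
case: (j == k); rewrite ?mulr1n ?mulr0n; apply/eqP; rewrite eq_complex /=;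
  by apply/andP; split; apply/eqP; simpc; field.
Qed.

(** The matrix of mixed second derivatives of rho^2 is the identity, so only the terms with equal
    indices survive. The factor 2 cancels that of the normalisation in [fund_form]. *)
Lemma i_ddbar_rho2 m (x X Y : 'rV[R]_(m.*2)) :
  complex.Re (i_ddbar (fun y => Complex (rho y ^+ 2) 0) x X Y)
  = 2 * dot (X *m Jmx R m) Y.
Proof.
rewrite /i_ddbar.
have -> : \sum_j \sum_k d_dz j (d_dzbar k
      (fun y : 'rV[R]_(m.*2) => Complex (rho y ^+ 2) 0)) x *
    (zcoord j X * (zcoord k Y)^*%C - zcoord j Y * (zcoord k X)^*%C)
  = \sum_j Complex 0 (2 * (X 0 (im_idx j) * Y 0 (re_idx j)
                        - X 0 (re_idx j) * Y 0 (im_idx j))).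
  apply: eq_bigr => j _; rewrite (bigD1 j) //= big1 => [|k kj].
    rewrite d_dzbar_rho2 d_dz_zcoord eqxx mul1r addr0 /zcoord; simpc.
    by congr Complex; ring.
  by rewrite d_dzbar_rho2 d_dz_zcoord eq_sym (negbTE kj) mul0r.
have -> : \sum_j Complex 0 (2 * (X 0 (im_idx j) * Y 0 (re_idx j)
                        - X 0 (re_idx j) * Y 0 (im_idx j)))
  = Complex 0 (- (2 * dot (X *m Jmx R m) Y)).
  rewrite /dot sum_re_im -mulrN -sumrN mulr_sumr.
  elim/big_rec2: _ => // j y1 y2 _ ->; simpc; congr Complex.
  by rewrite mulmx_J_re mulmx_J_im; ring.
by rewrite /=; ring.
Qed.

Lemma fund_formE m (x : 'rV[R]_(m.*2)) :
  fund_form x = (dot x x)^-1 *: Jmx R m.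
Proof.
apply/matrixP => i j; rewrite !mxE i_ddbar_rho2 rho2 dot_delta invfM.
rewrite -rowE mxE mulrACA.
by rewrite mulVf ?pnatr_eq0 // mul1r.
Qed.

Lemma hmetricE m (x : 'rV[R]_(m.*2)) : hmetric x = ((dot x x)^-1)%:M.
Proof.
rewrite /hmetric fund_formE -scalemxAr -scalerN.
suff -> : - (Jmx R m *m Jmx R m) = 1%:M by rewrite scalemx1.
by apply/row_matrixP => i; rewrite !rowE mulmxN mulmxA mulmx_JJ opprK mulmx1.
Qed.

Lemma invmx_hmetric m (x : 'rV[R]_(m.*2)) i j :
  invmx (hmetric x) i j = dot x x * (i == j)%:R.
Proof. by rewrite hmetricE invmx_scalar invrK mxE mulr_natr. Qed.

Lemma sum_delta n (f : 'I_n -> R) i : \sum_j f j * (i == j)%:R = f i.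
Proof.
rewrite (bigD1 i) //= big1 => [|j ji]; first by rewrite eqxx mulr1 addr0.
by rewrite eq_sym (negbTE ji) mulr0.
Qed.

Lemma pd_hmetric m (x : 'rV[R]_(m.*2)) i j l : x != 0 ->
  pd i (fun y : 'rV[R]_(m.*2) => hmetric y j l) x
  = - (2 * (j == l)%:R * x 0 i / dot x x ^+ 2).
Proof.
move=> x0; rewrite -pd_dotV //; congr pd; apply/funext => y.
by rewrite hmetricE mxE mulr_natl.
Qed.

Lemma pd_fund_form m (x : 'rV[R]_(m.*2)) i j l : x != 0 ->
  pd i (fun y : 'rV[R]_(m.*2) => fund_form y j l) x
  = - (2 * Jmx R m j l * x 0 i / dot x x ^+ 2).
Proof.
move=> x0; rewrite -pd_dotV //; congr pd; apply/funext => y.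
by rewrite fund_formE mxE mulrC.
Qed.

(** The metric is exp (2 phi) times the Euclidean one with phi = - ln rho, whose gradient is - x /
    |x|^2; this is the usual formula for a conformally flat metric. *)
Lemma christoffelE m (x : 'rV[R]_(m.*2)) k i j : x != 0 ->
  christoffel (@hmetric R m) x k i j =
  - (((k == j)%:R * x 0 i + (k == i)%:R * x 0 j - (i == j)%:R * x 0 k) / dot x x).
Proof.
move=> x0; have nz : dot x x != 0 by rewrite dot_eq0.
rewrite /christoffel.
under eq_bigr => l _ do rewrite invmx_hmetric !pd_hmetric // mulrAC.
rewrite sum_delta [j == k]eq_sym [i == k]eq_sym; field.
exact: nz.
Qed.

(** The constant form given by [Jmx] is closed, so only the differential of |x|^-2 contributes. This
    is the sole source of the torsion term. *)
Lemma dformE m (x : 'rV[R]_(m.*2)) i j k : x != 0 ->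
  dform (@fund_form R m) x i j k =
  - (2 / dot x x ^+ 2 * (Jmx R m i j * x 0 k + Jmx R m k i * x 0 j
                         + Jmx R m j k * x 0 i)).
Proof.
move=> x0; have nz : dot x x != 0 by rewrite dot_eq0.
by rewrite /dform !pd_fund_form //; field.
Qed.
End Metrics.

Local Notation i0 := (@re_idx 1 ord0).
Local Notation i1 := (@im_idx 1 ord0).

Lemma sum_plane (V : nmodType) (f : 'I_(1.*2) -> V) : \sum_i f i = f i0 + f i1.
Proof. by rewrite sum_re_im big_ord1. Qed.

Section FlowEquation.
Variables (R : realType) (n : nat).
Local Notation J := (Jmx R n).

(** The vector tau_+ as a function of the jet of the map: value y, first derivatives y1, y2, pure
    second derivatives y11, y22. The scalar c is |z|^2, the inverse of the conformal factor of the
    domain. *)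
Definition flow_rhs (c : R) (y y1 y2 y11 y22 : 'rV[R]_(n.*2)) :=
  let q := dot y y in
  c *: (y11 + y22 - (2 * dot y y1 / q) *: y1 - (2 * dot y y2 / q) *: y2
        + ((dot y1 y1 + dot y2 y2) / q) *: y
        + 2 *: ((dot y y2 / q) *: (y1 *m J) - (dot y y1 / q) *: (y2 *m J)
                - (dot (y1 *m J) y2 / q) *: y)).

Lemma christoffel_contract (y X Y : 'rV[R]_(n.*2)) i : y != 0 ->
  \sum_j \sum_k christoffel (@hmetric R n) y i j k * X 0 j * Y 0 k =
  - ((X 0 i * dot y Y + Y 0 i * dot y X - y 0 i * dot X Y) / dot y y).
Proof.
move=> y0.
transitivity (\sum_j \sum_k - (dot y y)^-1 *
    (X 0 j * y 0 j * (Y 0 k * (i == k)%:R) + (X 0 j * (i == j)%:R) * (y 0 k * Y 0 k)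
    - y 0 i * X 0 j * (Y 0 k * (j == k)%:R))).
  apply: eq_bigr => j _; apply: eq_bigr => k _.
  by rewrite christoffelE //; ring.
transitivity (\sum_j - (dot y y)^-1 * (X 0 j * y 0 j * Y 0 i
    + (X 0 j * (i == j)%:R) * dot y Y - y 0 i * (X 0 j * Y 0 j))).
  apply: eq_bigr => j _; rewrite -mulr_sumr sumrB big_split /= -!mulr_sumr.
  by rewrite !sum_delta -/(dot y Y); ring.
rewrite -mulr_sumr sumrB big_split /= -!mulr_suml -!mulr_sumr sum_delta.
have -> : \sum_j X 0 j * y 0 j = dot y X by apply: eq_bigr => j _; rewrite mulrC.
by rewrite -/(dot X Y); ring.
Qed.

Lemma dform_contract (y X Y : 'rV[R]_(n.*2)) i : y != 0 ->
  \sum_j \sum_k X 0 j * Y 0 k * dform (@fund_form R n) y i j k =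
  2 / dot y y ^+ 2 * (dot y Y * (X *m J) 0 i - dot y X * (Y *m J) 0 i
                      - dot (X *m J) Y * y 0 i).
Proof.
move=> y0.
have Jt j k : J j k = - J k j.
  move: j k; apply: re_im_ind => j; apply: re_im_ind => k; rewrite !JmxE ?oppr0 //.
    by rewrite opprK eq_sym.
  by rewrite eq_sym.
transitivity (\sum_j \sum_k (2 / dot y y ^+ 2) * ((X 0 j * J j i) * (y 0 k * Y 0 k)
    - y 0 j * X 0 j * (Y 0 k * J k i) - y 0 i * (X 0 j * J j k * Y 0 k))).
  apply: eq_bigr => j _; apply: eq_bigr => k _.
  by rewrite dformE // (Jt i j); ring.
transitivity (\sum_j (2 / dot y y ^+ 2) * ((X 0 j * J j i) * dot y Y
    - y 0 j * X 0 j * (Y *m J) 0 i - y 0 i * (\sum_k X 0 j * J j k * Y 0 k))).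
  apply: eq_bigr => j _; rewrite -mulr_sumr !sumrB -!mulr_sumr.
  by rewrite [(Y *m J) 0 i]mxE.
rewrite -mulr_sumr !sumrB -!mulr_suml -!mulr_sumr.
rewrite exchange_big /=.
have -> : \sum_k \sum_j X 0 j * J j k * Y 0 k = dot (X *m J) Y.
  by apply: eq_bigr => k _; rewrite -mulr_suml [(X *m J) 0 k]mxE.
have -> : \sum_j X 0 j * J j i = (X *m J) 0 i by rewrite mxE.
by rewrite -/(dot y X); ring.
Qed.

Variable F : 'rV[R]_(1.*2) -> 'rV[R]_(n.*2).

(** The inverse metric of the domain is scalar, so mixed second derivatives drop out of the trace.
    In dimension two the traced Christoffel symbols of the conformal metric cancel as well, which
    leaves |z|^2 times the flat Laplacian. *)
Lemma tau_plusE x (D1 D2 : 'I_(1.*2) -> 'rV[R]_(n.*2)) :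
  x != 0 -> F x != 0 ->
  (forall a i, pd a (fun y => F y 0 i) x = D1 a 0 i) ->
  (forall a i, pd a (pd a (fun y => F y 0 i)) x = D2 a 0 i) ->
  tau_plus (@hmetric R 1) (@fund_form R 1) (@hmetric R n) (@fund_form R n) F x
  = flow_rhs (dot x x) (F x) (D1 i0) (D1 i1) (D2 i0) (D2 i1).
Proof.
move=> x0 y0 h1 h2.
have nx : dot x x != 0 by rewrite dot_eq0.
have ny : dot (F x) (F x) != 0 by rewrite dot_eq0.
set y := F x in y0 ny *.
apply/rowP => i; rewrite mxE.
have gammaM c a : christoffel (@hmetric R 1) x c a a =
    - ((2 * (c == a)%:R * x 0 a - x 0 c) / dot x x).
  by rewrite christoffelE // eqxx !mul1r; ring.
have gammaN a : \sum_j \sum_k christoffel (@hmetric R n) y i j k *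
      pd a (fun y => F y 0 j) x * pd a (fun y => F y 0 k) x =
    - ((2 * dot y (D1 a) * D1 a 0 i
        - y 0 i * dot (D1 a) (D1 a)) / dot y y).
  transitivity (\sum_j \sum_k christoffel (@hmetric R n) y i j k *
      D1 a 0 j * D1 a 0 k).
    by apply: eq_bigr => j _; apply: eq_bigr => k _; rewrite !h1.
  by rewrite christoffel_contract //; ring.
have -> : tension (@hmetric R 1) (@hmetric R n) F x 0 i =
    dot x x * \sum_a (D2 a 0 i
      - (2 * dot y (D1 a) * D1 a 0 i
         - y 0 i * dot (D1 a) (D1 a)) / dot y y).
  rewrite mxE.
  under eq_bigr => a _ do under eq_bigr => b _ do rewrite invmx_hmetric mulrAC.
  under eq_bigr => a _ do rewrite sum_delta gammaN.
  rewrite !sum_plane !gammaM !idxE !eqxx !h2 !h1.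
  by rewrite !mulr1n !mulr0n; field; rewrite ny nx.
pose K c d := \sum_j \sum_k D1 c 0 j * D1 d 0 k *
  dform (@fund_form R n) y i j k.
(* The form on the plane is antisymmetric too, so the two off-diagonal terms agree and cancel the
   factor 1/2 of the torsion term. *)
have KN : K i1 i0 = - K i0 i1.
  rewrite /K !dform_contract // (dot_J (D1 i1)) (dotC (D1 i1)).
  by ring.
have -> : torsion_term (@hmetric R 1) (@fund_form R 1) (@hmetric R n)
      (@fund_form R n) F x 0 i = dot x x * dot y y * K i0 i1.
  rewrite mxE.
  have wE a b : fund_form x a b = (dot x x)^-1 * Jmx R 1 a b.
    by rewrite fund_formE mxE.
  have inner a b c d : \sum_j \sum_k \sum_l
      @fund_form R 1 x a b * pd c (fun y => F y 0 j) x * pd d (fun y => F y 0 k) x *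
      dform (@fund_form R n) (F x) l j k *
      invmx (@hmetric R 1 x) a c * invmx (@hmetric R 1 x) b d *
      invmx (@hmetric R n (F x)) l i =
    @fund_form R 1 x a b * (dot x x * (a == c)%:R) * (dot x x * (b == d)%:R) *
      dot y y * K c d.
    rewrite /K mulr_sumr; apply: eq_bigr => j _; rewrite mulr_sumr.
    apply: eq_bigr => k _.
    under eq_bigr => l _ do rewrite !invmx_hmetric [l == i]eq_sym mulrA.
    by rewrite sum_delta -/y !h1; ring.
  under eq_bigr => a _ do under eq_bigr => b _ do under eq_bigr => c _ do
    under eq_bigr => d _ do rewrite inner.
  rewrite !sum_plane !idxE !wE !JmxE !eqxx KN !mulr1n !mulr0n.
  by field.
rewrite /K dform_contract // sum_plane /flow_rhs -/y.
by rewrite !mxE; field.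
Qed.
End FlowEquation.

(** * Polar coordinates on the target *)

Section DerivativeRules.
Variable R : realType.
Implicit Types (f g : R -> R) (x a b : R).

Lemma is_derive_add f g x a b : is_derive x 1 f a -> is_derive x 1 g b ->
  is_derive x 1 (fun s => f s + g s) (a + b).
Proof. by move=> hf hg; exact: is_deriveD. Qed.

Lemma is_derive_opp f x a : is_derive x 1 f a ->
  is_derive x 1 (fun s => - f s) (- a).
Proof. by move=> hf; exact: is_deriveN. Qed.

Lemma is_derive_sub f g x a b : is_derive x 1 f a -> is_derive x 1 g b ->
  is_derive x 1 (fun s => f s - g s) (a - b).
Proof. by move=> hf hg; exact: is_deriveB. Qed.

Lemma is_derive_mul f g x a b : is_derive x 1 f a -> is_derive x 1 g b ->
  is_derive x 1 (fun s => f s * g s) (a * g x + f x * b).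
Proof.
move=> hf hg; apply: is_derive_eq (is_deriveM hf hg) _.
by rewrite /GRing.scale /=; ring.
Qed.

Lemma is_derive_cmul f x a b : is_derive x 1 f a ->
  is_derive x 1 (fun s => b * f s) (b * a).
Proof. by move=> hf; exact: (is_deriveZ (f := f)). Qed.

Lemma is_derive_inv f x a : f x != 0 -> is_derive x 1 f a ->
  is_derive x 1 (fun s => (f s)^-1) (- a / f x ^+ 2).
Proof.
move=> f0 hf; apply: is_derive_eq (is_deriveV f0 hf) _.
by rewrite /GRing.scale /= mulNr mulrC mulNr.
Qed.

Lemma is_derive_comp f g x a b : is_derive (g x) 1 f a -> is_derive x 1 g b ->
  is_derive x 1 (fun s => f (g s)) (a * b).
Proof. by move=> hf hg; exact: (is_derive1_comp hf hg). Qed.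
End DerivativeRules.

Section Curves.
Variables (R : realType) (n : nat).
Implicit Types (c d : R -> 'rV[R]_(n.*2)) (s : R).

Lemma is_derive_entry k (c0 : R -> 'rV[R]_k) (v : 'rV[R]_k) s i : is_derive s 1 c0 v ->
  is_derive s 1 (fun t => c0 t 0 i : R) (v 0 i).
Proof.
case=> dc <-; apply: DeriveDef; first by have /derivable_mxP := dc; apply.
by rewrite (derive_mx dc) mxE.
Qed.

Lemma is_derive_rV k (c0 : R -> 'rV[R]_k) (v : 'rV[R]_k) s :
  (forall i, is_derive s 1 (fun t => c0 t 0 i : R) (v 0 i)) ->
  is_derive s 1 c0 v.
Proof.
move=> h; have dc : derivable c0 s 1.
  by apply/derivable_mxP => i j; rewrite ord1; have [] := h j.
apply: DeriveDef => //; rewrite (derive_mx dc); apply/rowP => i.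
by rewrite mxE; have [_ ->] := h i.
Qed.

Lemma is_derive_curve_dot c d s v w : is_derive s 1 c v -> is_derive s 1 d w ->
  is_derive s 1 (fun t => dot (c t) (d t)) (dot v (d s) + dot (c s) w).
Proof.
move=> hc hd.
have -> : (fun t => dot (c t) (d t)) =
    \sum_i ((fun t => c t 0 i : R) * (fun t => d t 0 i : R)).
  by apply/funext => t; rewrite fct_sumE.
apply: is_derive_eq (is_derive_sum (fun i => is_deriveM
  (is_derive_entry i hc) (is_derive_entry i hd))) _.
rewrite /dot -big_split; apply: eq_bigr => i _.
by rewrite /GRing.scale /=; ring.
Qed.

Lemma is_derive_curve_add k (c0 d0 : R -> 'rV[R]_k) (v w : 'rV[R]_k) s : is_derive s 1 c0 v ->
  is_derive s 1 d0 w -> is_derive s 1 (fun t => c0 t + d0 t) (v + w).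
Proof. by move=> hc hd; exact: is_deriveD. Qed.

Lemma is_derive_curve_scale k (f : R -> R) (a : R) (c0 : R -> 'rV[R]_k) (v : 'rV[R]_k) s : is_derive s 1 f a ->
  is_derive s 1 c0 v ->
  is_derive s 1 (fun t => f t *: c0 t) (a *: c0 s + f s *: v).
Proof.
move=> hf hc; apply: is_derive_rV => i.
have := is_derive_mul hf (is_derive_entry i hc).
by rewrite !mxE; apply: near_eq_is_derive; near=> t; rewrite mxE.
Unshelve. all: by end_near. Qed.

Implicit Types (y v w : 'rV[R]_(n.*2)).

(** In y = exp r * sigma, [lnorm] is r and [dir] is sigma. The versions with suffix 1 and 2 are
    their first and second derivatives along a curve through y with velocity v and acceleration
    w. *)
Definition lnorm y := 2^-1 * ln (dot y y).
Definition lnorm1 y v := dot y v / dot y y.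
Definition lnorm2 y v w := (dot v v + dot y w) / dot y y - 2 * lnorm1 y v ^+ 2.
Definition dir y := expR (- lnorm y) *: y.
Definition dir1 y v := expR (- lnorm y) *: (v - lnorm1 y v *: y).
Definition dir2 y v w := expR (- lnorm y) *:
  (w - (2 * lnorm1 y v) *: v + (lnorm1 y v ^+ 2 - lnorm2 y v w) *: y).

Lemma expR_lnorm y : y != 0 -> expR (- lnorm y) ^+ 2 * dot y y = 1.
Proof.
rewrite -dot_gt0 => y0; rewrite expr2 -expRD /lnorm.
have -> : - (2^-1 * ln (dot y y)) + - (2^-1 * ln (dot y y)) = - ln (dot y y) by field.
by rewrite expRN lnK ?posrE // mulVf // gt_eqF.
Qed.

Lemma dot_dir y : y != 0 -> dot (dir y) (dir y) = 1.
Proof. by move=> y0; rewrite /dir dotZl dotZr mulrA -expr2 expR_lnorm. Qed.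

Lemma is_derive_lnorm c s v : c s != 0 -> is_derive s 1 c v ->
  is_derive s 1 (fun t => lnorm (c t)) (lnorm1 (c s) v).
Proof.
move=> c0 hc; have q0 : 0 < dot (c s) (c s) by rewrite dot_gt0.
apply: is_derive_eq (is_derive_cmul _ (is_derive_comp (is_derive1_ln q0)
  (is_derive_curve_dot hc hc))) _.
rewrite /lnorm1 (dotC v); field; exact: lt0r_neq0.
Qed.

Lemma is_derive_lnorm1 c c1 s v w : c s != 0 -> is_derive s 1 c v ->
  c1 s = v -> is_derive s 1 c1 w ->
  is_derive s 1 (fun t => lnorm1 (c t) (c1 t)) (lnorm2 (c s) v w).
Proof.
move=> c0 hc c1s hc1; have q0 : dot (c s) (c s) != 0 by rewrite dot_eq0.
apply: is_derive_eq (is_derive_mul (is_derive_curve_dot hc hc1)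
  (is_derive_inv q0 (is_derive_curve_dot hc hc))) _.
by rewrite /lnorm2 /lnorm1 c1s (dotC v (c s)); field.
Qed.

Lemma is_derive_expR_lnorm c s v : c s != 0 -> is_derive s 1 c v ->
  is_derive s 1 (fun t => expR (- lnorm (c t)))
    (- (expR (- lnorm (c s)) * lnorm1 (c s) v)).
Proof.
move=> c0 hc; apply: is_derive_eq (is_derive_comp (is_derive_expR _)
  (is_derive_opp (is_derive_lnorm c0 hc))) _.
by rewrite mulrN.
Qed.

Lemma is_derive_dir c s v : c s != 0 -> is_derive s 1 c v ->
  is_derive s 1 (fun t => dir (c t)) (dir1 (c s) v).
Proof.
move=> c0 hc; apply: is_derive_eq
  (is_derive_curve_scale (is_derive_expR_lnorm c0 hc) hc) _.
by rewrite /dir1; apply/rowP => i; rewrite !mxE; ring.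
Qed.

Lemma is_derive_dir1 c c1 s v w : c s != 0 -> is_derive s 1 c v ->
  c1 s = v -> is_derive s 1 c1 w ->
  is_derive s 1 (fun t => dir1 (c t) (c1 t)) (dir2 (c s) v w).
Proof.
move=> c0 hc c1s hc1.
have hl := is_derive_opp (is_derive_lnorm1 c0 hc c1s hc1).
have h : is_derive s 1 (fun t => c1 t + (- lnorm1 (c t) (c1 t)) *: c t) _ :=
  is_derive_curve_add hc1 (is_derive_curve_scale hl hc).
have := is_derive_curve_scale (is_derive_expR_lnorm c0 hc) h.
have -> : (fun t => expR (- lnorm (c t)) *: (c1 t + - lnorm1 (c t) (c1 t) *: c t))
  = (fun t => dir1 (c t) (c1 t)).
  by apply/funext => t; rewrite scaleNr.
move=> h'; apply: is_derive_eq h' _; rewrite /dir2 c1s.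
by apply/rowP => i; rewrite !mxE; ring.
Qed.
End Curves.

Section Gap.
Variables (R : realType) (n : nat) (kappa : R).
Hypothesis kappa0 : kappa != 0.
Implicit Types (y v w : 'rV[R]_(n.*2)).

Definition gap y z := 1 - dot (dir y) (dir z)
  + kappa ^- 2 * (1 - cos (kappa * (lnorm y - lnorm z))).

Definition gap1 y z v w := - (dot (dir1 y v) (dir z) + dot (dir y) (dir1 z w))
  + kappa^-1 * sin (kappa * (lnorm y - lnorm z)) * (lnorm1 y v - lnorm1 z w).

Definition gap2 y z v w v' w' :=
  - (dot (dir2 y v v') (dir z) + 2 * dot (dir1 y v) (dir1 z w)
     + dot (dir y) (dir2 z w w'))
  + cos (kappa * (lnorm y - lnorm z)) * (lnorm1 y v - lnorm1 z w) ^+ 2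
  + kappa^-1 * sin (kappa * (lnorm y - lnorm z)) * (lnorm2 y v v' - lnorm2 z w w').

Lemma is_derive_gap (c d : R -> 'rV[R]_(n.*2)) s v w : c s != 0 -> d s != 0 ->
  is_derive s 1 c v -> is_derive s 1 d w ->
  is_derive s 1 (fun t => gap (c t) (d t)) (gap1 (c s) (d s) v w).
Proof.
move=> c0 d0 hc hd.
have hdl := is_derive_cmul kappa
  (is_derive_sub (is_derive_lnorm c0 hc) (is_derive_lnorm d0 hd)).
have hcos := is_derive_cmul (kappa ^- 2) (is_derive_sub (is_derive_cst (1 : R) s 1)
  (is_derive_comp (is_derive_cos _) hdl)).
have hdot := is_derive_sub (is_derive_cst (1 : R) s 1)
  (is_derive_curve_dot (is_derive_dir c0 hc) (is_derive_dir d0 hd)).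
apply: is_derive_eq (is_derive_add hdot hcos) _.
by rewrite /gap1; field.
Qed.

Lemma is_derive_gap1 (c d c1 d1 : R -> 'rV[R]_(n.*2)) s v w v' w' :
  c s != 0 -> d s != 0 -> is_derive s 1 c v -> is_derive s 1 d w ->
  c1 s = v -> d1 s = w -> is_derive s 1 c1 v' -> is_derive s 1 d1 w' ->
  is_derive s 1 (fun t => gap1 (c t) (d t) (c1 t) (d1 t))
    (gap2 (c s) (d s) v w v' w').
Proof.
move=> c0 d0 hc hd c1s d1s hc1 hd1.
have hdl := is_derive_cmul kappa
  (is_derive_sub (is_derive_lnorm c0 hc) (is_derive_lnorm d0 hd)).
have hsin := is_derive_cmul (kappa^-1) (is_derive_comp (is_derive_sin _) hdl).
have hl := is_derive_sub (is_derive_lnorm1 c0 hc c1s hc1) (is_derive_lnorm1 d0 hd d1s hd1).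
have h1 := is_derive_curve_dot (is_derive_dir1 c0 hc c1s hc1) (is_derive_dir d0 hd).
have h2 := is_derive_curve_dot (is_derive_dir c0 hc) (is_derive_dir1 d0 hd d1s hd1).
apply: is_derive_eq (is_derive_add (is_derive_opp (is_derive_add h1 h2))
  (is_derive_mul hsin hl)) _.
by rewrite /gap2 c1s d1s; field.
Qed.
End Gap.

(** * The flow equation in polar form and the inequality for the gap *)

Section FlowInPolarForm.
Variables (R : realType) (n : nat).
Implicit Types (y v w : 'rV[R]_(n.*2)).
Local Notation J := (Jmx R n).

Lemma dir1_J y v :
  dir1 y v *m J = expR (- lnorm y) *: (v *m J - lnorm1 y v *: (y *m J)).
Proof. by rewrite /dir1 -scalemxAl mulmxBl -scalemxAl. Qed.

Lemma dot_expR y : y != 0 -> dot y y = expR (- lnorm y) ^- 2.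
Proof.
move=> y0; have e0 : expR (- lnorm y) ^+ 2 != 0.
  by rewrite expf_neq0 // gt_eqF ?expR_gt0.
by apply: (mulfI e0); rewrite expR_lnorm // mulfV.
Qed.

(** The equation for r, expressed through jets; [dir1_flow] is the one for sigma. *)
Lemma lnorm1_flow c y y1 y2 y11 y22 : y != 0 ->
  lnorm1 y (flow_rhs c y y1 y2 y11 y22) =
  c * (lnorm2 y y1 y11 + lnorm2 y y2 y22
       - 2 * dot (dir1 y y1 *m J) (dir1 y y2)).
Proof.
move=> y0; have q0 : dot y y != 0 by rewrite dot_eq0.
rewrite dir1_J /dir1 ?(dotZl, dotZr).
have := expR_lnorm y0; set e := expR _ => eq.
have -> x : e * (e * x) = x / dot y y.
  by apply: (canRL (mulfK q0)); rewrite -[RHS]mul1r -eq; ring.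
rewrite /flow_rhs /lnorm1 /lnorm2 /lnorm1 !dotE.
rewrite dot_J_id (dotC y (y1 *m J)) (dotC y (y2 *m J)) (dot_J y2) (dotC y2).
by field.
Qed.

Lemma dir1_flow c y y1 y2 y11 y22 : y != 0 ->
  dir1 y (flow_rhs c y y1 y2 y11 y22) =
  c *: (dir2 y y1 y11 + dir2 y y2 y22
    + sphere_term (dir y) (dir1 y y1) (dir1 y y2) (lnorm1 y y1) (lnorm1 y y2)).
Proof.
move=> y0; have q0 : dot y y != 0 by rewrite dot_eq0.
rewrite {1}/dir1 lnorm1_flow // /sphere_term /twist !dir1_J.
rewrite /flow_rhs /dir2 /dir1 /dir ?(dotZl, dotZr).
have eq := dot_expR y0; have e0 : expR (- lnorm y) != 0 by rewrite gt_eqF ?expR_gt0.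
move: (expR _) eq e0 => e eq e0.
rewrite /lnorm2 /lnorm1 ?(dotBl, dotBr, dotZl, dotZr).
rewrite dot_J_id (dotC y1 y) (dotC y2 y) (dot_J y y2) (dotC y (y2 *m J)).
move: (y *m J) (y1 *m J) (y2 *m J) => yJ y1J y2J.
rewrite !eq; apply/rowP => i; rewrite !mxE.
by field.
Qed.
End FlowInPolarForm.

Section GapDecay.
Variables (R : realType) (n : nat) (kappa : R).
Hypothesis kappa0 : kappa != 0.
Implicit Types (y z : 'rV[R]_(n.*2)).
Local Notation J := (Jmx R n).

Lemma sphere_term_scale k (s s1 s2 : 'rV[R]_(n.*2)) r1 r2 :
  sphere_term s (k *: s1) (k *: s2) (k * r1) (k * r2)
  = k ^+ 2 *: sphere_term s s1 s2 r1 r2.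
Proof.
rewrite /sphere_term /twist -!scalemxAl ?(dotBl, dotZl, dotZr).
move: (s1 *m J) (s2 *m J) => s1J s2J.
by apply/rowP => i; rewrite !mxE; ring.
Qed.

(** All terms on the left are quadratic in the derivatives, so c is absorbed by multiplying each
    derivative by its square root. With c = |z|^2 the hypotheses become scale-invariant. *)
Lemma comparison_estimate_scaled c (s S s1 s2 S1 S2 : 'rV[R]_(n.*2))
    (r1 r2 R1 R2 cs mu : R) : 0 <= c ->
  dot s s = 1 -> dot S S = 1 ->
  c * dot S1 S1 <= 1 -> c * dot S2 S2 <= 1 -> c * R1 ^+ 2 <= 1 -> c * R2 ^+ 2 <= 1 ->
  2^-1 <= cs -> 2 * (1 - dot s S) <= 400^-1 -> mu ^+ 2 <= 400^-1 ->
  c * (- dot (sphere_term s s1 s2 r1 r2) S - dot s (sphere_term S S1 S2 R1 R2)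
  + 2 * (dot s1 S1 + dot s2 S2)
  - cs * ((r1 - R1) ^+ 2 + (r2 - R2) ^+ 2)
  - 2 * mu * (dot (s1 *m J) s2 - dot (S1 *m J) S2))
  <= 140 * (2 * (1 - dot s S) + mu ^+ 2).
Proof.
move=> c0 ss SS hS1 hS2 hR1 hR2 hcs hD hmu.
pose k := Num.sqrt c; have k2 : k ^+ 2 = c by rewrite sqr_sqrtr.
have := @comparison_estimate R n s S (k *: s1) (k *: s2) (k *: S1) (k *: S2)
  (k * r1) (k * r2) (k * R1) (k * R2) cs mu ss SS.
rewrite !sphere_term_scale -!scalemxAl ?(dotZl, dotZr) ![k * (k * _)]mulrA -!expr2.
rewrite !exprMn !k2 => /(_ hS1 hS2 hR1 hR2 hcs hD hmu); apply: le_trans.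
by rewrite le_eqVlt -!mulrBr exprMn exprMn k2; apply/orP; left; apply/eqP; ring.
Qed.

Lemma dot_dir_le1 y z : y != 0 -> z != 0 -> dot (dir y) (dir z) <= 1.
Proof.
move=> y0 z0; apply: le_trans (ler_norm _) _.
by rewrite -[leRHS]mul1r dot_le ?ler01 // ?dot_dir // expr1n.
Qed.

(** The quantity squared in the third inequality is the derivative of the second summand of [gap]
    with respect to r - R. It is controlled by that summand because sin^2 = (1 - cos) (1 + cos). *)
Lemma gap_parts y z : y != 0 -> z != 0 ->
  [/\ 0 <= 1 - dot (dir y) (dir z),
      0 <= kappa ^- 2 * (1 - cos (kappa * (lnorm y - lnorm z)))
    & (kappa^-1 * sin (kappa * (lnorm y - lnorm z))) ^+ 2
      <= 2 * (kappa ^- 2 * (1 - cos (kappa * (lnorm y - lnorm z))))].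
Proof.
move=> y0 z0; set t := kappa * _.
have k0 : 0 <= kappa ^- 2 by rewrite invr_ge0 sqr_ge0.
split; first by rewrite subr_ge0 dot_dir_le1.
  by rewrite mulr_ge0 // subr_ge0 cos_le1.
rewrite exprMn exprVn [leRHS]mulrCA ler_wpM2l //.
have := cos2Dsin2 t; have := cos_le1 t; have := cos_geN1 t => h1 h2 h3.
by nra.
Qed.

Lemma gap_ge0 y z : y != 0 -> z != 0 -> 0 <= gap kappa y z.
Proof. by move=> y0 z0; have [h1 h2 _] := gap_parts y0 z0; rewrite addr_ge0. Qed.

(** Once the polar equations are inserted, the second derivatives cancel against those in [gap2] and
    the expression of [comparison_estimate] remains. The smallness hypotheses provide its bounds
    1/400 and 1/2 for the cosine. Finally 2 (1 - P) + mu^2 is at most twice the gap, so 140 becomes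
    280. *)
Lemma gap1_flow_le c y z y1 y2 y11 y22 z1 z2 z11 z22 :
  y != 0 -> z != 0 -> 0 < c ->
  c * dot (dir1 z z1) (dir1 z z1) <= 1 -> c * dot (dir1 z z2) (dir1 z z2) <= 1 ->
  c * lnorm1 z z1 ^+ 2 <= 1 -> c * lnorm1 z z2 ^+ 2 <= 1 ->
  gap kappa y z <= 800^-1 -> kappa ^+ 2 * gap kappa y z <= 2^-1 ->
  gap1 kappa y z (flow_rhs c y y1 y2 y11 y22) (flow_rhs c z z1 z2 z11 z22)
  <= c * (gap2 kappa y z y1 z1 y11 z11 + gap2 kappa y z y2 z2 y22 z22)
     + 280 * gap kappa y z.
Proof.
move=> y0 z0 c0 hz1 hz2 hr1 hr2 hg hkg.
have [p1 p2 p3] := gap_parts y0 z0.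
have gE : gap kappa y z = 1 - dot (dir y) (dir z)
  + kappa ^- 2 * (1 - cos (kappa * (lnorm y - lnorm z))) by [].
set t := kappa * (lnorm y - lnorm z) in p2 p3 gE.
set P := dot (dir y) (dir z) in p1 gE.
set mu := kappa^-1 * sin t in p3.
have hcs : 2^-1 <= cos t.
  have : kappa ^+ 2 * (kappa ^- 2 * (1 - cos t)) <= 2^-1.
    by apply: le_trans hkg; rewrite ler_wpM2l ?sqr_ge0 // gE lerDr.
  by rewrite mulVKf ?expf_neq0 //; lra.
have a1 : 2 * (1 - P) <= 400^-1 by lra.
have a2 : mu ^+ 2 <= 400^-1 by lra.
have main := comparison_estimate_scaled (dir1 y y1) (dir1 y y2) (lnorm1 y y1)
  (lnorm1 y y2) (ltW c0) (dot_dir y0) (dot_dir z0) hz1 hz2 hr1 hr2 hcs a1 a2.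
have b : 140 * (2 * (1 - P) + mu ^+ 2) <= 280 * gap kappa y z by lra.
apply: le_trans (lerD (lexx _) b); rewrite -lerBlDl; apply: le_trans main.
rewrite /gap1 /gap2 -/t -/mu !dir1_flow // !lnorm1_flow //.
clear.
move: (dir y) (dir z) (dir1 y y1) (dir1 y y2) (dir1 z z1) (dir1 z z2).
move: (dir2 y y1 y11) (dir2 y y2 y22) (dir2 z z1 z11) (dir2 z z2 z22).
move=> A1 A2 B1 B2 s S s1 s2 S1 S2.
move: (sphere_term s _ _ _ _) (sphere_term S _ _ _ _) => N N'.
by rewrite ?(dotZl, dotZr, dotDl, dotDr) le_eqVlt; apply/orP; left; apply/eqP; ring.
Qed.
End GapDecay.

(** * Derivatives along lines and the maximum principle *)

Section Lines.
Variables (R : realType) (V W : normedModType R).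
Implicit Types (f : V -> W) (x v : V) (s t : R).

Lemma is_derive_line f x v s : derivable f (s *: v + x) v ->
  is_derive s 1 (fun t => f (t *: v + x)) ('D_v f (s *: v + x)).
Proof.
have e : (fun h : R => h^-1 *: (((fun t => f (t *: v + x)) \o shift s) (h *: 1)
    - f (s *: v + x)))
  = (fun h : R => h^-1 *: ((f \o shift (s *: v + x)) (h *: v) - f (s *: v + x))).
  apply/funext => h /=; congr (_ *: (f _ - _)).
  by rewrite [h *: 1]mulr1 scalerDl addrA.
by move=> d; apply: DeriveDef; rewrite /derivable /derive e.
Qed.

Lemma near_line (U : set V) x v : open U -> U x ->
  exists2 e : R, 0 < e & forall s, `|s| < e -> U (s *: v + x).
Proof.
move=> oU Ux.
have c : (fun s : R => s *: v + x) @ (0 : R) --> x.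
  rewrite -[X in _ --> X]add0r -[X in X + _](scale0r v).
  apply: cvgD; last exact: cvg_cst.
  exact: scalel_continuous.
have hU : nbhs x U by exact: open_nbhs_nbhs.
have /nbhs_ballP [e /= e0 he] : nbhs (0 : R) (fun s => U (s *: v + x)) := c _ hU.
exists e => // s se; apply: he.
by rewrite /ball /= sub0r normrN.
Qed.
End Lines.

Section MaximumTests.
Variable R : realType.

(** At the maximum g' vanishes. If g2 were positive, g' would be positive just to the right of 0,
    and by the mean value theorem g would exceed its maximum. *)
Lemma second_derivative_max (g g' : R -> R) (g2 e : R) : 0 < e ->
  (forall s : R, `|s| < e -> is_derive s 1 g (g' s)) ->
  is_derive (0 : R) 1 g' g2 -> (forall s : R, `|s| < e -> g s <= g 0) -> g2 <= 0.
Proof.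
move=> e0 hg [dg' g2E] hmax; rewrite leNgt; apply/negP => g20.
have itv (s : R) : s \in `]- e, e[ -> `|s| < e by rewrite in_itv /= -ltr_norml.
have g'0 : g' 0 = 0.
  have h0 : (0 : R) \in `]- e, e[ by rewrite in_itv /= oppr_lt0 e0.
  have le_ee : - e <= e by rewrite ge0_cp // ltW.
  have dg t : t \in `]- e, e[ -> derivable g t 1 by move=> /itv /hg [].
  have mg t : t \in `]- e, e[ -> g t <= g 0 by move=> /itv /hmax.
  have [_ d0] := @derive1_at_max R g (- e) e 0 le_ee dg h0 mg.
  by have [_ d0'] := hg 0 (itv _ h0); exact: etrans (esym d0') d0.
have : \forall h \near (0 : R)^', 0 < h^-1 *: ((g' \o shift 0) (h *: 1) - g' 0).
  by move: dg' => /cvgr_gt; apply; rewrite -/(derive _ _ _) g2E.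
rewrite near_withinE => /nbhs_ballP [d /= d0 hd].
pose s := Num.min e d / 2.
have s0 : 0 < s by rewrite divr_gt0 // lt_min e0.
have sd : s < Num.min e d by rewrite ltr_pdivrMr // ltr_pMr ?ltr1n // lt_min e0.
have [se sd'] : s < e /\ s < d by move: sd; rewrite lt_min => /andP.
have hder x : x \in `]0, s[ -> is_derive x 1 g (g' x).
  rewrite in_itv /= => /andP[x0 xs]; apply: hg.
  by rewrite ger0_norm ?ltW // (lt_trans xs).
have hcont : {within `[0, s], continuous g}.
  apply: derivable_within_continuous => x; rewrite in_itv /= => /andP[x0 xs].
  have : `|x| < e by rewrite ger0_norm // (le_lt_trans xs).
  by move=> /hg [].
have [c + gE] := MVT s0 hder hcont.
rewrite in_itv /= => /andP[c0 cs].
have : 0 < g' c.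
  have := hd c; rewrite /ball /= sub0r normrN gtr0_norm // (lt_trans cs sd') => /(_ isT).
  rewrite gt_eqF // => /(_ isT); rewrite g'0 subr0 /= addr0 [c *: 1]mulr1.
  by rewrite pmulr_rgt0 // invr_gt0.
have : g s <= g 0 by apply: hmax; rewrite gtr0_norm.
rewrite -subr_le0 gE subr0 => h1 h2.
by have := mulr_gt0 h2 s0; rewrite ltNge h1.
Qed.

(** The test is one-sided because at a first contact only earlier times can be compared. *)
Lemma left_derivative_ge0 (g : R -> R) (d e : R) : 0 < e ->
  is_derive (0 : R) 1 g d -> (forall s : R, - e < s -> s < 0 -> g s <= g 0) -> 0 <= d.
Proof.
move=> e0 [dg dE] hmax; rewrite leNgt; apply/negP => d0.
have : \forall h \near (0 : R)^', h^-1 *: ((g \o shift 0) (h *: 1) - g 0) < 0.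
  by move: dg => /cvgr_lt; apply; rewrite -/(derive _ _ _) dE.
rewrite near_withinE => /nbhs_ballP [r /= r0 hr].
pose s := - (Num.min e r / 2).
have s0 : 0 < - s by rewrite opprK divr_gt0 // lt_min e0.
have sd : - s < Num.min e r by rewrite opprK ltr_pdivrMr // ltr_pMr ?ltr1n // lt_min e0.
have [se sr] : - s < e /\ - s < r by move: sd; rewrite lt_min => /andP.
have := hr s; rewrite /ball /= sub0r normrN -normrN gtr0_norm // sr => /(_ isT).
rewrite -oppr_eq0 gt_eqF // => /(_ isT); rewrite addr0 [s *: 1]mulr1.
rewrite ltNge => /negP; apply.
rewrite -[_ *: _]mulrNN mulr_ge0 //.
  by rewrite -invrN invr_ge0 ltW.
rewrite oppr_ge0 subr_le0 hmax //; first by rewrite ltrNl.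
by rewrite -oppr_gt0.
Qed.
End MaximumTests.

Section Slices.
Variables (R : realType) (k n : nat).
Local Notation V := (R^o * 'rV[R]_k)%type.
Implicit Types (F : V -> 'rV[R]_n) (t : R) (z : 'rV[R]_k).

Definition space_dir (a : 'I_k) : V := (0, delta_mx 0 a).

Lemma derive_slice (W : normedModType R) (G : V -> W) t z (e : 'rV[R]_k) :
  'D_e (fun y => G (t, y)) z = 'D_((0, e) : V) G (t, z).
Proof.
rewrite /derive.
suff -> : (fun h : R => h^-1 *: (((fun y => G (t, y)) \o shift z) (h *: e) - G (t, z)))
  = (fun h : R => h^-1 *: ((G \o shift ((t, z) : V)) (h *: ((0, e) : V)) - G (t, z))).
  by [].
apply/funext => h /=.
suff -> : h *: ((0, e) : V) + (t, z) = (t, h *: e + z) by [].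
by congr pair; rewrite /= scaler0 add0r.
Qed.

Lemma pd_slice F t z a i : derivable F (t, z) (space_dir a) ->
  pd a (fun y => F (t, y) 0 i) z = ('D_(space_dir a) F (t, z)) 0 i.
Proof.
by move=> d; rewrite /pd (derive_slice (fun p => F p 0 i : R^o)) (derive_mx d) mxE.
Qed.

Lemma pd2_slice (U : set V) F t z a i : open U -> U (t, z) -> smooth_on U F ->
  pd a (pd a (fun y => F (t, y) 0 i)) z
  = ('D_(space_dir a) ('D_(space_dir a) F) (t, z)) 0 i.
Proof.
move=> oU Utz sF.
have [d1 _] := sF [::] (t, z) Utz; have [d2 _] := sF [:: space_dir a] (t, z) Utz.
rewrite -(pd_slice (F := 'D_(space_dir a) F)); last exact: d2.
(* The inner partial derivative is to be differentiated again, so it must be identified on a whole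
   neighbourhood of z within the slice. *)
apply: near_eq_derive.
have : nbhs ((t, z) : V) U by exact: open_nbhs_nbhs.
case=> -[A B] /= [hA hB] hAB; apply: filterS hB => y By.
have Uy : U (t, y) by apply: hAB; split=> //=; exact: nbhs_singleton.
by have [d _] := sF [::] (t, y) Uy; apply: pd_slice; apply: d.
Qed.
End Slices.

(** * Invariance of the gap under scaling *)

Section PolarScaling.
Variables (R : realType) (n : nat).
Implicit Types (y z : 'rV[R]_(n.*2)).

Lemma lnorm_scale (a : R) y : 0 < a -> y != 0 -> lnorm (a *: y) = ln a + lnorm y.
Proof.
move=> a0 y0; rewrite /lnorm dotZl dotZr.
rewrite lnM ?posrE ?mulr_gt0 ?dot_gt0 // lnM ?posrE ?mulr_gt0 ?dot_gt0 //.
by field.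
Qed.

Lemma dir_scale (a : R) y : 0 < a -> y != 0 -> dir (a *: y) = dir y.
Proof.
move=> a0 y0; rewrite /dir lnorm_scale // scalerA opprD expRD expRN lnK ?posrE //.
by rewrite mulrAC mulVf ?mul1r ?gt_eqF.
Qed.

Lemma dir_eq y z : y != 0 -> z != 0 -> dir y = dir z ->
  y = expR (lnorm y - lnorm z) *: z.
Proof.
move=> y0 z0 h; rewrite expRD -scalerA -[expR (- lnorm z) *: z]/(dir z) -h.
by rewrite /dir scalerA -expRD subrr expR0 scale1r.
Qed.

Lemma exprz_expR (a : R) (k : int) : 0 < a -> a ^ k = expR (k%:~R * ln a).
Proof.
move=> a0; case: k => m /=.
  by rewrite -[m%:~R]/(m%:R) -[LHS]/(a ^+ m) expRM_natl lnK ?posrE.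
by rewrite NegzE mulrNz mulNr expRN -[_%:~R]/(m.+1%:R) expRM_natl lnK ?posrE.
Qed.

Lemma cosD2pi_int (k : int) (x : R) : cos (x + k%:~R * (pi *+ 2)) = cos x.
Proof.
case: k => m; rewrite ?NegzE ?mulrNz ?mulNr -[_%:~R]/(_%:R) mulr_natl.
  by rewrite (periodicn (@cosD2pi R)).
by rewrite -[LHS](periodicn (@cosD2pi R) m.+1) subrK.
Qed.

(** Reduce x modulo 2 pi to u in [0, 2 pi[. The cosine is injective on [0, pi], which forces u = 0
    in the lower half; in the upper half it would force 2 pi - u = 0. *)
Lemma cos_eq1 (x : R) : cos x = 1 -> exists k : int, x = k%:~R * (pi *+ 2).
Proof.
have p0 : 0 < pi *+ 2 :> R by rewrite mulrn_wgt0 // pi_gt0.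
pose k := Num.floor (x / (pi *+ 2)).
pose u := x - k%:~R * (pi *+ 2).
have /andP[k1 k2] := real_floor_itv (num_real (x / (pi *+ 2))).
have u0 : 0 <= u by rewrite subr_ge0 -ler_pdivlMr.
have u1 : u < pi *+ 2.
  by rewrite ltrBlDr -{1}[pi *+ 2]mul1r -mulrDl -ltr_pdivrMr // addrC -[1]/(1%:~R) -intrD.
have cu : cos u = cos x.
  by rewrite -(cosD2pi_int k u) /u subrK.
move=> cx; rewrite cx in cu; exists k; apply/eqP; rewrite -subr_eq0 -/u; apply/eqP.
have [upi|piu] := leP u pi.
  apply: cos_inj; rewrite ?in_itv /= ?lexx ?pi_ge0 ?u0 //.
  by rewrite cu cos0.
have : pi *+ 2 - u = 0.
  apply: cos_inj; rewrite ?in_itv /= ?lexx ?pi_ge0 //.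
    by rewrite subr_ge0 ltW //= mulr2n lerBlDr lerD2l ltW.
  by rewrite -cosN opprB -(cosD2pi_int 1) mul1r subrK cos0.
by move=> h; move: u1; rewrite -subr_gt0 h ltxx.
Qed.

Variable alpha : R.
Hypothesis alpha1 : 1 < alpha.
Let alpha0 : 0 < alpha. Proof. exact: lt_trans ltr01 alpha1. Qed.

Definition hopf_freq := pi *+ 2 / ln alpha.
Local Notation hgap := (gap hopf_freq).

Lemma ln_alpha_gt0 : 0 < ln alpha.
Proof. by rewrite ln_gt0. Qed.

Lemma hopf_freq_gt0 : 0 < hopf_freq.
Proof. by rewrite divr_gt0 ?ln_alpha_gt0 // mulrn_wgt0 // pi_gt0. Qed.

Lemma scale_neq0 (k : int) y : y != 0 -> alpha ^ k *: y != 0.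
Proof. by move=> y0; rewrite scaler_eq0 negb_or y0 andbT gt_eqF // exprz_gt0. Qed.

Lemma ln_alphaX (k : int) : ln (alpha ^ k) = k%:~R * ln alpha.
Proof. by rewrite exprz_expR // expRK. Qed.

(** The direction is unchanged and the phase kappa * r moves by 2 pi k, since kappa * ln alpha = 2
    pi. Moving one argument alone is what makes the gap independent of the choice of a local
    lift. *)
Lemma gap_scalel (k : int) y z : y != 0 -> hgap (alpha ^ k *: y) z = hgap y z.
Proof.
move=> y0; have ak : 0 < alpha ^ k by rewrite exprz_gt0.
rewrite /gap dir_scale // lnorm_scale // ln_alphaX.
have -> : hopf_freq * (k%:~R * ln alpha + lnorm y - lnorm z)
    = hopf_freq * (lnorm y - lnorm z) + k%:~R * (pi *+ 2).
  by rewrite /hopf_freq; field; rewrite gt_eqF ?ln_alpha_gt0.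
by rewrite cosD2pi_int.
Qed.

Lemma gap_scale (k : int) y z : y != 0 -> z != 0 ->
  hgap (alpha ^ k *: y) (alpha ^ k *: z) = hgap y z.
Proof.
move=> y0 z0; have ak : 0 < alpha ^ k by rewrite exprz_gt0.
rewrite /gap !dir_scale // !lnorm_scale //.
by rewrite opprD addrACA subrr add0r.
Qed.

Lemma gap_refl y : y != 0 -> hgap y y = 0.
Proof.
by move=> y0; rewrite /gap dot_dir // !subrr mulr0 cos0 subrr mulr0 addr0.
Qed.

(** Both summands are nonnegative, so both vanish: the first gives equal directions, the second a
    difference of logarithms in the lattice generated by ln alpha. *)
Lemma gap_eq0 y z : y != 0 -> z != 0 -> hgap y z = 0 ->
  exists k : int, y = alpha ^ k *: z.
Proof.
move=> y0 z0 /eqP; have [h1 h2 _] := gap_parts hopf_freq y0 z0.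
rewrite /gap paddr_eq0 // mulf_eq0 invr_eq0 expf_eq0 (gt_eqF hopf_freq_gt0) /=.
rewrite !subr_eq0.
move=> /andP[/eqP e1 /eqP/esym/cos_eq1 [k hk]].
have dyz : dir y = dir z.
  apply/eqP; rewrite -subr_eq0 -dot_eq0 dotBl !dotBr !dot_dir // (dotC (dir z)) -e1.
  by rewrite !subrr.
exists k; rewrite [LHS](dir_eq y0 z0 dyz) exprz_expR //; congr (expR _ *: _).
have f0 : hopf_freq != 0 by rewrite gt_eqF ?hopf_freq_gt0.
apply: (mulfI f0); rewrite hk /hopf_freq; field.
by rewrite gt_eqF ?ln_alpha_gt0.
Qed.

(** The annulus 1 <= |y| <= alpha meets every orbit; the exponent is minus the integer part of ln
    |y| / ln alpha. Being compact, it replaces the torus in the maximum principle. *)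
Lemma scale_to_annulus y : y != 0 -> exists k : int,
  1 <= dot (alpha ^ k *: y) (alpha ^ k *: y) <= alpha ^+ 2.
Proof.
move=> y0; have L0 := ln_alpha_gt0.
pose k := - Num.floor (lnorm y / ln alpha); exists k.
have e w : w != 0 -> dot w w = expR (2 * lnorm w).
  by move=> w0; rewrite /lnorm mulrA mulfV // mul1r lnK ?posrE ?dot_gt0.
have ak : 0 < alpha ^ k by rewrite exprz_gt0.
rewrite e ?scale_neq0 // lnorm_scale // ln_alphaX.
have /andP[k1 k2] := real_floor_itv (num_real (lnorm y / ln alpha)).
have -> : alpha ^+ 2 = expR (2 * ln alpha).
  by rewrite expRM_natl lnK.
rewrite /k mulrNz mulNr addrC -{1}expR0 !ler_expR ler_pM2l //.
rewrite mulr_ge0 ?subr_ge0 -?ler_pdivlMr //= lerBlDr -{1}[ln alpha]mul1r -mulrDl.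
by rewrite -ler_pdivrMr // addrC ltW // -[1]/(1%:~R) -intrD.
Qed.
End PolarScaling.

(** * The gap at a spatial maximum *)

Section FlowComparison.
Variables (R : realType) (n : nat).
Local Notation V := (R^o * 'rV[R]_(1.*2))%type.
Implicit Types (U : set V) (phi F : V -> 'rV[R]_(n.*2)) (t : R) (z : 'rV[R]_(1.*2)).

Definition flow_rhs_at phi (p : V) :=
  flow_rhs (dot p.2 p.2) (phi p)
    ('D_(space_dir R i0) phi p) ('D_(space_dir R i1) phi p)
    ('D_(space_dir R i0) ('D_(space_dir R i0) phi) p)
    ('D_(space_dir R i1) ('D_(space_dir R i1) phi) p).

Lemma flow_rhs_at_eq phi p y y1 y2 y11 y22 : phi p = y ->
  'D_(space_dir R i0) phi p = y1 -> 'D_(space_dir R i1) phi p = y2 ->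
  'D_(space_dir R i0) ('D_(space_dir R i0) phi) p = y11 ->
  'D_(space_dir R i1) ('D_(space_dir R i1) phi) p = y22 ->
  flow_rhs_at phi p = flow_rhs (dot p.2 p.2) y y1 y2 y11 y22.
Proof. by move=> <- <- <- <- <-. Qed.

Lemma tau_plus_slice U phi t z : open U -> U (t, z) -> smooth_on U phi ->
  z != 0 -> phi (t, z) != 0 ->
  tau_plus (@hmetric R 1) (@fund_form R 1) (@hmetric R n) (@fund_form R n)
    (fun y => phi (t, y)) z = flow_rhs_at phi (t, z).
Proof.
move=> oU Utz sphi z0 phi0.
apply: (tau_plusE (D1 := fun a => 'D_(space_dir R a) phi (t, z))
  (D2 := fun a => 'D_(space_dir R a) ('D_(space_dir R a) phi) (t, z))) => // a i.
  by apply: pd_slice; have [d _] := sphi [::] _ Utz; exact: d.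
exact: (pd2_slice _ _ oU Utz sphi).
Qed.

(** The vector |z| e_a has length one in the metric of the torus, so these are intrinsic bounds on
    the derivatives of the polar parts of [phi]. *)
Definition unit_gradient phi (p : V) (a : 'I_(1.*2)) :=
  dot p.2 p.2 * dot (dir1 (phi p) ('D_(space_dir R a) phi p))
                    (dir1 (phi p) ('D_(space_dir R a) phi p)) <= 1 /\
  dot p.2 p.2 * lnorm1 (phi p) ('D_(space_dir R a) phi p) ^+ 2 <= 1.

Lemma space_line (s : R) a t z :
  s *: space_dir R a + (t, z) = (t, s *: delta_mx 0 a + z) :> V.
Proof. by congr pair; rewrite /= scaler0 add0r. Qed.

Lemma gap1_at_max kappa U phi F t z :
  kappa != 0 -> open U -> U (t, z) -> smooth_on U phi -> smooth_on U F ->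
  z != 0 ->
  (forall y, U (t, y) -> phi (t, y) != 0) -> (forall y, U (t, y) -> F (t, y) != 0) ->
  'D_(1, 0) phi (t, z) = flow_rhs_at phi (t, z) ->
  'D_(1, 0) F (t, z) = flow_rhs_at F (t, z) ->
  (forall a, unit_gradient F (t, z) a) ->
  gap kappa (phi (t, z)) (F (t, z)) <= 800^-1 ->
  kappa ^+ 2 * gap kappa (phi (t, z)) (F (t, z)) <= 2^-1 ->
  (forall y, U (t, y) -> gap kappa (phi (t, y)) (F (t, y))
                      <= gap kappa (phi (t, z)) (F (t, z))) ->
  gap1 kappa (phi (t, z)) (F (t, z)) ('D_(1, 0) phi (t, z)) ('D_(1, 0) F (t, z))
  <= 280 * gap kappa (phi (t, z)) (F (t, z)).
Proof.
move=> k0 oU Utz sphi sF z0 phi0 F0 ephi eF gF g1 g2 gmax.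
have h2 a : gap2 kappa (phi (t, z)) (F (t, z))
    ('D_(space_dir R a) phi (t, z)) ('D_(space_dir R a) F (t, z))
    ('D_(space_dir R a) ('D_(space_dir R a) phi) (t, z))
    ('D_(space_dir R a) ('D_(space_dir R a) F) (t, z)) <= 0.
  have [e e0 he] := near_line (space_dir R a) oU Utz.
  have e1 : (0 : R) *: space_dir R a + (t, z) = (t, z) :> V by rewrite scale0r add0r.
  have n0 : `|(0 : R)| < e by rewrite normr0.
  pose l (G : V -> 'rV[R]_(n.*2)) (s : R) := G (s *: space_dir R a + (t, z)).
  have line (G : V -> 'rV[R]_(n.*2)) (s : R) : smooth_on U G -> `|s| < e ->
      is_derive s 1 (l G) (l ('D_(space_dir R a) G) s).
    by move=> sG /he Us; apply: is_derive_line; have [d _] := sG [::] _ Us; exact: d.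
  have line2 (G : V -> 'rV[R]_(n.*2)) : smooth_on U G ->
      is_derive (0 : R) 1 (l ('D_(space_dir R a) G))
        (l ('D_(space_dir R a) ('D_(space_dir R a) G)) 0).
    move=> sG; have [d _] := sG [:: space_dir R a] _ (he _ n0).
    by apply: is_derive_line; apply: d.
  have nz G : (forall y, U (t, y) -> G (t, y) != 0) -> forall s : R, `|s| < e ->
      l G s != 0.
    by move=> hG s /he; rewrite /l space_line; exact: hG.
  have l0 G : l G 0 = G (t, z) by rewrite /l e1.
  rewrite -(l0 phi) -(l0 F) -(l0 ('D_(space_dir R a) phi)) -(l0 ('D_(space_dir R a) F))
    -(l0 ('D_(space_dir R a) ('D_(space_dir R a) phi)))
    -(l0 ('D_(space_dir R a) ('D_(space_dir R a) F))).
  apply: (@second_derivative_max R (fun s => gap kappa (l phi s) (l F s))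
    (fun s => gap1 kappa (l phi s) (l F s) (l ('D_(space_dir R a) phi) s)
       (l ('D_(space_dir R a) F) s)) _ e e0).
  - move=> s se; exact: (is_derive_gap k0 (nz _ phi0 _ se) (nz _ F0 _ se)
      (line _ _ sphi se) (line _ _ sF se)).
  - exact: (is_derive_gap1 k0 (nz _ phi0 _ n0) (nz _ F0 _ n0) (line _ _ sphi n0)
      (line _ _ sF n0) erefl erefl (line2 _ sphi) (line2 _ sF)).
  - move=> s se; rewrite !l0 /l space_line; apply: gmax.
    by rewrite -space_line; exact: he.
rewrite ephi eF.
have [gF1 gR1] := gF i0; have [gF2 gR2] := gF i1.
have c0 : 0 < dot z z by rewrite dot_gt0.
apply: le_trans (gap1_flow_le k0 _ _ _ _ _ _ (phi0 _ Utz) (F0 _ Utz) c0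
  gF1 gF2 gR1 gR2 g1 g2) _.
rewrite gerDr pmulr_rle0 // -[leRHS]addr0.
exact: lerD (h2 i0) (h2 i1).
Qed.

Lemma cvg_entry (T : topologicalType) k (x : T) (c : T -> 'rV[R]_k) i :
  {for x, continuous c} -> {for x, continuous (fun q => c q 0 i : R)}.
Proof.
move=> hc; apply: (@continuous_comp _ _ _ c (fun v : 'rV[R]_k => v 0 i : R) x hc).
exact: coord_continuous.
Qed.

Lemma continuous_dot (T : topologicalType) (x : T) (c d : T -> 'rV[R]_(n.*2)) :
  {for x, continuous c} -> {for x, continuous d} ->
  {for x, continuous (fun q => dot (c q) (d q))}.
Proof.
move=> hc hd; apply: cvg_big => [|i _]; first exact: add_continuous.
by apply: cvgM; apply: cvg_entry.
Qed.

Lemma continuous_lnorm (T : topologicalType) (x : T) (c : T -> 'rV[R]_(n.*2)) :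
  c x != 0 -> {for x, continuous c} -> {for x, continuous (fun q => lnorm (c q))}.
Proof.
move=> c0 hc; apply: cvgMl_tmp.
apply: (@continuous_comp _ _ _ (fun q => dot (c q) (c q)) (@ln R)).
  exact: continuous_dot.
by apply: continuous_ln; rewrite dot_gt0.
Qed.

Lemma continuous_gap (T : topologicalType) kappa (x : T)
    (c d : T -> 'rV[R]_(n.*2)) : c x != 0 -> d x != 0 ->
  {for x, continuous c} -> {for x, continuous d} ->
  {for x, continuous (fun q => gap kappa (c q) (d q))}.
Proof.
move=> c0 d0 hc hd.
have cl := continuous_lnorm c0 hc; have dl := continuous_lnorm d0 hd.
have cdir (g : T -> 'rV[R]_(n.*2)) : {for x, continuous g} ->
    {for x, continuous (fun q => lnorm (g q))} -> {for x, continuous (fun q => dir (g q))}.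
  move=> hg hl; apply: cvgZ => //.
  apply: (@continuous_comp _ _ _ (fun q => - lnorm (g q)) (@expR R)).
    exact: cvgN.
  exact: continuous_expR.
apply: cvgD.
  by apply: cvgB; [exact: cvg_cst | exact: (continuous_dot (cdir _ hc cl) (cdir _ hd dl))].
apply: cvgMl_tmp; apply: cvgB; first exact: cvg_cst.
apply: (@continuous_comp _ _ _ (fun q => kappa * (lnorm (c q) - lnorm (d q))) (@cos R)).
  by apply: cvgMl_tmp; apply: cvgB.
exact: continuous_cos.
Qed.
End FlowComparison.

(** * Uniqueness of the flow *)

Section HopfPoints.
Variables (R : realType) (alpha : R).

Lemma hopf_pi_eqP m (x y : 'rV[R]_(m.*2)) (hx : x != 0) (hy : y != 0) :
  hopf_pi alpha hx = hopf_pi alpha hy <-> exists k : int, y = alpha ^ k *: x.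
Proof. by split=> [/eqmodP/asboolP|h]; [|apply/eqmodP/asboolP]. Qed.

Lemma hopf_piP m (p : hopf alpha m) :
  exists (x : 'rV[R]_(m.*2)) (hx : x != 0), p = hopf_pi alpha hx.
Proof.
by case: (repr p) (reprK p) => x hx e; exists x, hx; rewrite -e.
Qed.

Variables (m n : nat).
Implicit Types (f : hopf alpha m -> hopf alpha n).

(** With a constant function, [lifts_at f (fun=> y) z] says that y lies over the value of f at the
    class of z. *)
Lemma lifts_at_exists f z : z != 0 -> exists y, lifts_at f (fun=> y) z.
Proof.
move=> z0; have [y [y0 e]] := hopf_piP (f (hopf_pi alpha z0)).
by exists y, z0, y0.
Qed.

Lemma lifts_at_unique f y y' z : lifts_at f (fun=> y) z -> lifts_at f (fun=> y') z ->
  exists k : int, y' = alpha ^ k *: y.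
Proof.
move=> [z0 [y0 e]] [z0' [y0' e']].
by apply/(hopf_pi_eqP y0 y0'); rewrite -e -e' (Prop_irrelevance z0 z0').
Qed.

Lemma lifts_at_scale f (k l : int) y z : 0 < alpha ->
  lifts_at f (fun=> y) z -> lifts_at f (fun=> alpha ^ l *: y) (alpha ^ k *: z).
Proof.
move=> a0 [z0 [y0 e]].
have sc j p (w : 'rV[R]_p) : w != 0 -> alpha ^ j *: w != 0.
  by move=> w0; rewrite scaler_eq0 negb_or w0 andbT gt_eqF // exprz_gt0.
exists (sc _ _ _ z0), (sc _ _ _ y0).
have <- : hopf_pi alpha z0 = hopf_pi alpha (sc k _ _ z0) by apply/hopf_pi_eqP; exists k.
by rewrite e; apply/hopf_pi_eqP; exists l.
Qed.
End HopfPoints.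

Section Annulus.
Variables (R : realType) (n : nat).

Lemma closed_superlevel (T : topologicalType) (f : T -> R) (c : R) : continuous f ->
  closed [set z | c <= f z].
Proof.
move=> cf; rewrite (_ : [set z | _] = f @^-1` [set x | c <= x]) //.
by apply: closed_comp; [move=> x _; exact: cf | exact: closed_ge].
Qed.

Lemma closed_sublevel (T : topologicalType) (f : T -> R) (c : R) : continuous f ->
  closed [set z | f z <= c].
Proof.
move=> cf; rewrite (_ : [set z | _] = f @^-1` [set x | x <= c]) //.
by apply: closed_comp; [move=> x _; exact: cf | exact: closed_le].
Qed.

Lemma open_punctured : open [set z : 'rV[R]_(n.*2) | z != 0].
Proof.
have -> : [set z : 'rV[R]_(n.*2) | z != 0] =
    (fun z : 'rV[R]_(n.*2) => dot z z) @^-1` [set x | 0 < x].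
  by apply/seteqP; split=> z /=; rewrite dot_gt0.
apply: open_comp; last exact: open_gt.
by move=> z _; apply: continuous_dot; exact: cvg_id.
Qed.

Lemma compact_annulus (a b : R) :
  compact [set z : 'rV[R]_(n.*2) | a <= dot z z <= b ^+ 2].
Proof.
have cd : continuous (fun z : 'rV[R]_(n.*2) => dot z z).
  by move=> z; apply: continuous_dot; exact: cvg_id.
apply: bounded_closed_compact.
  exists `|b|; split; first exact: num_real.
  move=> M bM z /= /andP[_ zb]; rewrite ltW //; apply: le_lt_trans bM.
  rewrite [leLHS]/Num.Def.normr /= mx_normrE; apply/bigmax_leP; split=> //= -[i j] _ /=.
  rewrite -(ler_pXn2r (_ : 0 < 2)%N) ?nnegrE // !real_normK ?num_real //.
  apply: le_trans zb; rewrite ord1 /dot (bigD1 j) //= -expr2 lerDl.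
  by apply: sumr_ge0 => k _; rewrite -expr2 sqr_ge0.
have -> : [set z : 'rV[R]_(n.*2) | a <= dot z z <= b ^+ 2] =
    [set z | a <= dot z z] `&` [set z | dot z z <= b ^+ 2].
  by apply/seteqP; split=> z /= => [/andP[]|[-> ->]].
by apply: closedI; [exact: closed_superlevel | exact: closed_sublevel].
Qed.
End Annulus.

Section FlowUniqueness.
Variables (R : realType) (alpha : R).
Hypothesis alpha1 : 1 < alpha.
Local Notation V := (R^o * 'rV[R]_(1.*2))%type.
Variables (T : \bar R) (f : R -> torus alpha -> hopf_surface alpha).
Variable F : V -> 'rV[R]_(2.*2).
Hypothesis flow_f : dbar_flow T f.
Hypothesis smooth_F : smooth_on setT F.
Hypothesis F_neq0 : forall t z, z != 0 -> F (t, z) != 0.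
Hypothesis flow_F : forall t z, z != 0 -> 'D_(1, 0) F (t, z) = flow_rhs_at F (t, z).
Hypothesis gradient_F : forall t z a, z != 0 -> unit_gradient F (t, z) a.
Hypothesis F_scale : forall t z (k : int), F (t, alpha ^ k *: z) = alpha ^ k *: F (t, z).
Hypothesis init_F : forall z, z != 0 -> lifts_at (f 0) (fun y => F (0, y)) z.

Let alpha0 : 0 < alpha. Proof. exact: lt_trans ltr01 alpha1. Qed.
Local Notation kappa := (hopf_freq alpha).
Local Notation lift t y z := (lifts_at (f t) (fun=> y) z).
Let kappa0 : kappa != 0. Proof. by rewrite gt_eqF ?hopf_freq_gt0. Qed.

Lemma lift_neq0 t y z : lift t y z -> z != 0 /\ y != 0.
Proof. by move=> [z0 [y0 _]]. Qed.

Lemma gap_lift t y y' z w : lift t y z -> lift t y' z -> gap kappa y w = gap kappa y' w.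
Proof.
move=> h h'; have [k ->] := lifts_at_unique h h'.
by rewrite gap_scalel //; have [] := lift_neq0 h.
Qed.

Lemma local_flow t z : 0 <= t -> (t%:E < T)%E -> z != 0 ->
  exists (U : set V) (phi : V -> 'rV[R]_(2.*2)),
    [/\ open U, U (t, z), smooth_on U phi,
        'D_(1, 0) phi (t, z) = flow_rhs_at phi (t, z)
      & forall s y, U (s, y) -> 0 <= s -> (s%:E < T)%E -> lift s (phi (s, y)) y].
Proof.
move=> t0 tT z0; have [U [phi [oU Utz sphi h]]] := flow_f t0 tT z0.
have [l e] := h _ _ Utz t0 tT.
exists U, phi; split=> //; last by move=> s y Us s0 sT; have [] := h _ _ Us s0 sT.
rewrite e; apply: tau_plus_slice oU Utz sphi z0 _.
by have [] := @lift_neq0 t (phi (t, z)) z l.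
Qed.

(** * The barrier argument *)

Section Barrier.
Variables (T' eta : R).

Hypothesis T'T : (T'%:E < T)%E.
Hypothesis eta0 : 0 < eta.
Hypothesis eta_small : eta * expR (300 * T') <= 800^-1.
Hypothesis eta_small2 : kappa ^+ 2 * (eta * expR (300 * T')) <= 2^-1.

(** The rate 300 is any number above the 280 of [gap1_at_max]. The smallness of [eta] keeps the
    barrier, up to time T', in the range where that estimate applies. *)
Definition barrier t := eta * expR (300 * t).
Definition annulus := [set z : 'rV[R]_(1.*2) | 1 <= dot z z <= alpha ^+ 2].
Definition box : set V := `[0, T'] `*` annulus.

(* The lift [y] is arbitrary because [gap] is invariant under scaling. *)
Definition above_barrier : set V :=
  [set p | box p /\ exists2 y, lift p.1 y p.2 & barrier p.1 <= gap kappa y (F p)].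

Lemma annulus_neq0 z : annulus z -> z != 0.
Proof.
by rewrite /annulus /= => /andP[z1 _]; rewrite -dot_gt0 (lt_le_trans ltr01).
Qed.

Lemma box_compact : compact box.
Proof. by apply: compact_setX; [exact: segment_compact | exact: compact_annulus]. Qed.

Lemma time_lt t : t <= T' -> (t%:E < T)%E.
Proof. by move=> tT; apply: le_lt_trans T'T; rewrite lee_fin. Qed.

Lemma F_continuous p : {for p, continuous F}.
Proof. by have [] := smooth_F [::] (x := p) I. Qed.

Lemma barrier_continuous : continuous barrier.
Proof.
move=> t; apply: cvgMl_tmp.
apply: (@continuous_comp _ _ _ (fun s : R => 300 * s) (@expR R) t).
  by apply: cvgMl_tmp; exact: cvg_id.
exact: continuous_expR.
Qed.

(** Near a limit point the flow supplies a continuous local lift. If the gap were below the barrier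
    at the limit point, it would be so nearby; a nearby point of the set may come with another lift,
    but the gap does not see the difference. *)
Lemma above_barrier_closed : closed above_barrier.
Proof.
have cbox : closed box by apply: compact_closed box_compact; exact: norm_hausdorff.
move=> p hp; have bp : box p by apply: cbox; apply: closureS hp => q [].
split=> //; case: p hp bp => t z hp [] /=; rewrite in_itv /= => /andP[t0 tT] az.
have z0 := annulus_neq0 az.
have [U [phi [oU Utz sphi _ hl]]] := local_flow t0 (time_lt tT) z0.
have l := hl _ _ Utz t0 (time_lt tT); have [_ p0] := lift_neq0 l.
exists (phi (t, z)) => //; rewrite leNgt; apply/negP => lt.
have cphi : {for (t, z), continuous phi} by have [_] := sphi [::] _ Utz.
have cg : {for (t, z), continuous (fun q : V => barrier q.1 - gap kappa (phi q) (F q))}.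
  apply: cvgB.
    apply: (@continuous_comp _ _ _ (fun q : V => q.1 : R) barrier).
      exact: cvg_fst.
    exact: barrier_continuous.
  by apply: continuous_gap => //; [exact: F_neq0 | exact: F_continuous].
have near_lt : \forall q \near ((t, z) : V), 0 < barrier q.1 - gap kappa (phi q) (F q).
  by move: cg => /cvgr_gt; apply; rewrite /= subr_gt0.
have hU : nbhs ((t, z) : V) U by exact: open_nbhs_nbhs.
have [[s y] [[[] /=]]] := hp _ (filterI hU near_lt).
rewrite in_itv /= => /andP[s0 sT] ay [w lw bw] [Us].
rewrite subr_gt0 ltNge => /negP; apply.
by rewrite -(gap_lift _ lw) //; apply: hl => //; exact: time_lt.
Qed.

Lemma barrier_le t : t <= T' -> barrier t <= eta * expR (300 * T').
Proof. by move=> tT; rewrite (ler_pM2l eta0) ler_expR (ler_wpM2l (ler0n _ _)). Qed.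

Section FirstContact.
Variable t : R.
Hypotheses (t_gt0 : 0 < t) (tT : t <= T').
Hypothesis below : forall s z y, 0 <= s -> s < t -> z != 0 -> lift s y z ->
  gap kappa y (F (s, z)) < barrier s.

Lemma time_line (r : R) (z : 'rV[R]_(1.*2)) : r *: ((1, 0) : V) + (t, z) = (r + t, z) :> V.
Proof. by congr pair; rewrite /= ?scaler0 ?add0r // [r *: 1]mulr1. Qed.

Lemma is_derive_excess U phi z : open U -> U (t, z) -> smooth_on U phi ->
  z != 0 -> phi (t, z) != 0 ->
  is_derive (0 : R) 1
    (fun r : R => gap kappa (phi (r *: ((1, 0) : V) + (t, z)))
                            (F (r *: ((1, 0) : V) + (t, z))) - barrier (r + t))
    (gap1 kappa (phi (t, z)) (F (t, z)) ('D_(1, 0) phi (t, z)) ('D_(1, 0) F (t, z))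
     - 300 * barrier t).
Proof.
move=> oU Utz sphi z0 p0.
have e0 : (0 : R) *: ((1, 0) : V) + (t, z) = (t, z) :> V by rewrite scale0r add0r.
have line (G : V -> 'rV[R]_(2.*2)) (W : set V) : smooth_on W G -> W (t, z) ->
    is_derive (0 : R) 1 (fun r => G (r *: ((1, 0) : V) + (t, z)))
      ('D_((1, 0) : V) G ((0 : R) *: ((1, 0) : V) + (t, z))).
  move=> sG Wtz; apply: is_derive_line; rewrite e0.
  by have [d _] := sG [::] _ Wtz; exact: d.
have hb : is_derive (0 : R) 1 (fun r => barrier (r + t)) (300 * barrier t).
  have hlin : is_derive (0 : R) 1 (fun r : R => 300 * (r + t)) (300 * (1 + 0)).
    exact: (is_derive_cmul 300 (is_derive_add (is_derive_id _ _) (is_derive_cst t _ _))).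
  apply: is_derive_eq (is_derive_cmul eta (is_derive_comp (is_derive_expR _) hlin)) _.
  by rewrite add0r addr0 mulr1 /barrier; ring.
have hg := @is_derive_gap R 2 kappa kappa0
  (fun r => phi (r *: ((1, 0) : V) + (t, z))) (fun r => F (r *: ((1, 0) : V) + (t, z)))
  0 _ _ _ _ (line _ _ sphi Utz) (line _ _ smooth_F I).
have := is_derive_sub (hg _ _) hb; rewrite !e0; apply=> //; exact: F_neq0.
Qed.

(** If the gap exceeded the barrier at time t, it would, by continuity along the local lift, do so
    shortly before. The weak inequality at all z makes a contact point a spatial maximum. *)
Lemma contact_le z y : z != 0 -> lift t y z -> gap kappa y (F (t, z)) <= barrier t.
Proof.
move=> z0 ly; have t0 := ltW t_gt0.
have [U [phi [oU Utz sphi _ hl]]] := local_flow t0 (time_lt tT) z0.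
have lphi := hl _ _ Utz t0 (time_lt tT); have [_ p0] := lift_neq0 lphi.
rewrite (gap_lift _ ly lphi) -subr_le0 leNgt; apply/negP => gt0.
have hd := is_derive_excess oU Utz sphi z0 p0.
set g := (fun r : R => _) in hd.
have g0 : 0 < g 0 by rewrite /g scale0r !add0r.
have cg : {for (0 : R), continuous g}.
  by apply: differentiable_continuous; apply/derivable1_diffP; have [] := hd.
have /nbhs_ballP[e /= e0 he] : \forall r \near (0 : R), 0 < g r.
  by move: cg => /cvgr_gt; apply.
have [e' e'0 he'] := near_line ((1, 0) : V) oU Utz.
pose m := Num.min t (Num.min e e'); pose r := - (m / 2).
have m0 : 0 < m by rewrite !lt_min t_gt0 e0 e'0.
have rm : m / 2 < m by rewrite ltr_pdivrMr // ltr_pMr ?ltr1n.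
have [rt re re'] : [/\ m / 2 < t, m / 2 < e & m / 2 < e'].
  by move: rm; rewrite {2}/m !lt_min => /andP[? /andP[]].
have r2 : 0 < m / 2 by rewrite divr_gt0.
have nr : `|r| = m / 2 by rewrite normrN gtr0_norm.
have : 0 < g r by apply: he; rewrite /ball /= sub0r normrN nr.
have := he' r; rewrite nr => /(_ re'); rewrite /g time_line => Ur.
have s0 : 0 <= r + t by rewrite addrC subr_ge0 ltW.
have st : r + t < t by rewrite gtrDr oppr_lt0.
rewrite subr_gt0 ltNge ltW //; apply: below => //.
by apply: hl => //; apply: time_lt; rewrite ltW // (lt_le_trans st).
Qed.

(** At a contact the gap equals the barrier, which is constant in space, so the point is a spatial
    maximum and the time derivative of the gap is at most 280 times the barrier. Comparison with
    earlier times shows that it is at least 300 times the barrier. *)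
Lemma no_contact z y : z != 0 -> lift t y z -> gap kappa y (F (t, z)) < barrier t.
Proof.
move=> z0 ly; rewrite lt_neqAle contact_le // andbT; apply/eqP => contact.
have t0 := ltW t_gt0.
have [U [phi [oU Utz sphi ephi hl]]] := local_flow t0 (time_lt tT) z0.
have lphi := hl _ _ Utz t0 (time_lt tT); have [_ p0] := lift_neq0 lphi.
rewrite (gap_lift _ ly lphi) in contact.
pose U' := U `&` [set p : V | p.2 != 0].
have hd := is_derive_excess oU Utz sphi z0 p0.
have [e e0 he] := near_line ((1, 0) : V) oU Utz.
have ge0 := @left_derivative_ge0 R _ _ (Num.min e t) _ hd.
have bt := barrier_le tT.
have b0 : 0 < barrier t by rewrite mulr_gt0 ?expR_gt0.
have max1 : gap1 kappa (phi (t, z)) (F (t, z)) ('D_(1, 0) phi (t, z))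
    ('D_(1, 0) F (t, z)) <= 280 * gap kappa (phi (t, z)) (F (t, z)).
  apply: (@gap1_at_max R 2 kappa U' phi F t z kappa0) => //.
  - apply: openI => //.
    by apply: (open_comp _ (@open_punctured R 1)) => p _; exact: cvg_snd.
  - by move=> vs p [Up _]; exact: sphi.
  - by move=> vs p _; exact: smooth_F.
  - by move=> w [Uw _]; have [] := lift_neq0 (hl _ _ Uw t0 (time_lt tT)).
  - by move=> w [_ /= w0]; exact: F_neq0.
  - exact: flow_F.
  - by move=> a; exact: gradient_F.
  - by rewrite contact (le_trans bt).
  - by rewrite contact (le_trans _ eta_small2) // ler_wpM2l ?sqr_ge0.
  - move=> w [Uw /= w0]; rewrite contact; apply: contact_le => //.
    exact: (hl _ _ Uw t0 (time_lt tT)).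
move: max1; rewrite contact leNgt => /negP; apply.
rewrite (@lt_le_trans _ _ (300 * barrier t)) ?ltr_pM2r ?ltr_nat //.
rewrite -subr_ge0; apply: ge0; first by rewrite lt_min e0 t_gt0.
move=> r; rewrite ltrNl lt_min => /andP[re rt] r0.
rewrite scale0r !add0r contact subrr time_line subr_le0 ltW //.
have Ur : U (r + t, z) by rewrite -time_line; apply: he; rewrite ltr0_norm.
have s0 : 0 <= r + t by rewrite -lerBlDl sub0r ltW.
have st : r + t < t by rewrite gtrDr.
apply: below => //; apply: hl => //.
by apply: time_lt; rewrite ltW // (lt_le_trans st).
Qed.
End FirstContact.

(** A nonempty compact set has a point of least time. This time is positive because the gap vanishes
    initially, and [no_contact] then rules the point out: any earlier point above the barrier could
    be scaled into the annulus, against minimality. *)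
Lemma above_barrier_empty p : ~ above_barrier p.
Proof.
move=> hp.
have cB : compact above_barrier.
  by apply: subclosed_compact above_barrier_closed box_compact _ => q [].
have [[t z]] : exists2 q, q \in above_barrier & forall q', q' \in above_barrier ->
    (q.1 : R) <= q'.1.
  apply: compact_EVT_min => //; first by exists p.
  by apply: continuous_subspaceT => q; exact: cvg_fst.
rewrite inE => -[[] /=]; rewrite in_itv /= => /andP[t0 tT] az [y ly by_] hmin.
have z0 := annulus_neq0 az.
have t_gt0 : 0 < t.
  rewrite lt_neqAle t0 andbT; apply/eqP => t00; move: by_; rewrite leNgt => /negP; apply.
  have l0 := init_F z0; rewrite -t00 in ly *.
  rewrite (gap_lift _ ly l0) gap_refl ?F_neq0 //.
  by rewrite mulr_gt0 ?expR_gt0.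
move: by_; rewrite leNgt => /negP; apply; apply: no_contact => // s w v s0 st w0 lv.
rewrite ltNge; apply/negP => bv.
have [k ak] := scale_to_annulus alpha1 w0.
have lv' := lifts_at_scale k k alpha0 lv.
have [_ v0] := lift_neq0 lv.
have /hmin : ((s, alpha ^ k *: w) : V) \in above_barrier.
  rewrite inE; split; first by split=> //=; rewrite in_itv /= s0 (le_trans (ltW st)).
  exists (alpha ^ k *: v) => //=.
  by rewrite F_scale gap_scale // F_neq0.
by rewrite /= leNgt st.
Qed.
End Barrier.

Theorem flow_unique t z : 0 <= t -> (t%:E < T)%E -> z != 0 ->
  lifts_at (f t) (fun y => F (t, y)) z.
Proof.
move=> t0 tT z0; have [y ly] := lifts_at_exists (f t) z0.
have [_ y0] := lift_neq0 ly; have F0 := F_neq0 t z0.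
suff : gap kappa y (F (t, z)) = 0.
  move=> /(gap_eq0 alpha1 y0 F0)[k yE].
  suff : lift t (F (t, z)) z by [].
  have := lifts_at_scale 0 (- k) alpha0 ly.
  by rewrite expr0z scale1r yE scalerA -invr_expz mulVf ?scale1r // gt_eqF ?exprz_gt0.
apply/eqP; rewrite eq_le gap_ge0 // ?kappa0 // andbT leNgt; apply/negP => g0.
set G := gap kappa y _ in g0.
have e0 : 0 < expR (300 * t) by exact: expR_gt0.
have k20 : 0 < kappa ^+ 2 by rewrite exprn_gt0 ?hopf_freq_gt0.
(* [m] is to be the height of the barrier at time t: below both thresholds of the estimate, and at
   most the assumed positive gap G, so that the point rescaled to the annulus lies above the
   barrier. *)
pose m := Num.min (Num.min 800^-1 (2^-1 / kappa ^+ 2)) G.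
have m0 : 0 < m by rewrite !lt_min invr_gt0 ltr0n divr_gt0 ?invr_gt0 ?ltr0n.
have [m1 m2 m3] : [/\ m <= 800^-1, m <= 2^-1 / kappa ^+ 2 & m <= G].
  by split; rewrite !ge_min lexx ?orbT.
pose eta := m / expR (300 * t).
have etaE : eta * expR (300 * t) = m by rewrite mulfVK ?gt_eqF.
have eta0 : 0 < eta by rewrite divr_gt0.
have [k ak] := scale_to_annulus alpha1 z0.
apply: (@above_barrier_empty t eta tT eta0 _ _ ((t, alpha ^ k *: z) : V)).
- by rewrite etaE.
- by rewrite etaE mulrC -ler_pdivlMr.
split; first by split=> //=; rewrite in_itv /= t0 lexx.
exists (alpha ^ k *: y); first exact: lifts_at_scale.
by rewrite /= F_scale gap_scale // /barrier etaE.
Qed.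
End FlowUniqueness.

(** * The explicit solution *)

Section LinearMaps.
Variables (R : realType) (n : nat).
Implicit Types (u v w : 'rV[R]_(n.*2)) (z : 'rV[R]_(1.*2)).

Definition plane_map u v z := z 0 i0 *: u + z 0 i1 *: v.

Definition orthonormal_pair u v := [/\ dot u u = 1, dot v v = 1 & dot u v = 0].

Lemma dot_plane z z' : dot z z' = z 0 i0 * z' 0 i0 + z 0 i1 * z' 0 i1.
Proof. by rewrite /dot sum_plane. Qed.

Lemma dot_plane_map u v z : orthonormal_pair u v ->
  dot (plane_map u v z) (plane_map u v z) = dot z z.
Proof.
move=> [uu vv uv]; rewrite /plane_map ?(dotDl, dotDr, dotZl, dotZr) (dotC v u) uu vv uv.
by rewrite dot_plane; ring.
Qed.

Lemma plane_map_neq0 u v z : orthonormal_pair u v -> z != 0 -> plane_map u v z != 0.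
Proof. by move=> o; rewrite -!dot_gt0 dot_plane_map. Qed.

Lemma plane_map_scale u v (a : R) z : plane_map u v (a *: z) = a *: plane_map u v z.
Proof. by rewrite /plane_map !mxE scalerDr !scalerA. Qed.

(** For an orthonormal pair, y = [plane_map u v z] satisfies |y| = |z|, <y, u> = x^1 and <y, v> =
    x^2. Hence the denominators cancel against |z|^2, the terms of the tension cancel each other,
    and the rest is again linear in z; its coefficients are the right-hand sides of the ODE. *)
Lemma plane_flow_rhs u v z : orthonormal_pair u v -> z != 0 ->
  flow_rhs (dot z z) (plane_map u v z) u v 0 0 =
  plane_map (- (2 *: (v *m Jmx R n)) - (2 * dot (u *m Jmx R n) v) *: u)
            (2 *: (u *m Jmx R n) - (2 * dot (u *m Jmx R n) v) *: v) z.
Proof.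
move=> o z0; have c0 : dot z z != 0 by rewrite dot_eq0.
rewrite /flow_rhs dot_plane_map //; have [uu vv uv] := o.
have -> : dot (plane_map u v z) u = z 0 i0.
  by rewrite /plane_map dotDl !dotZl (dotC v) uu uv; ring.
have -> : dot (plane_map u v z) v = z 0 i1.
  by rewrite /plane_map dotDl !dotZl vv uv; ring.
rewrite uu vv /plane_map; move: (u *m _) (v *m _) (dot _ v) => uJ vJ a.
by apply/rowP => i; rewrite !mxE; field.
Qed.

(** For a unit vector w in the direction of differentiation, the squares of the tangential and
    radial parts, multiplied by |z|^2, add up to 1 because the linear map is isometric. *)
Lemma plane_unit_gradient u v z : orthonormal_pair u v -> z != 0 ->
  (dot z z * dot (dir1 (plane_map u v z) u) (dir1 (plane_map u v z) u) <= 1 /\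
   dot z z * lnorm1 (plane_map u v z) u ^+ 2 <= 1) /\
  (dot z z * dot (dir1 (plane_map u v z) v) (dir1 (plane_map u v z) v) <= 1 /\
   dot z z * lnorm1 (plane_map u v z) v ^+ 2 <= 1).
Proof.
move=> o z0; have [uu vv uv] := o; have c0 : 0 < dot z z by rewrite dot_gt0.
have y0 := plane_map_neq0 o z0; have yy := dot_plane_map z o.
have yu : dot (plane_map u v z) u = z 0 i0.
  by rewrite /plane_map dotDl !dotZl (dotC v) uu uv; ring.
have yv : dot (plane_map u v z) v = z 0 i1.
  by rewrite /plane_map dotDl !dotZl vv uv; ring.
have gen w r : dot w w = 1 -> dot (plane_map u v z) w = r -> r ^+ 2 <= dot z z ->
    dot z z * dot (dir1 (plane_map u v z) w) (dir1 (plane_map u v z) w) <= 1 /\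
    dot z z * lnorm1 (plane_map u v z) w ^+ 2 <= 1.
  move=> ww yw hr; have e := expR_lnorm y0; rewrite yy in e.
  have l2 : dot z z * lnorm1 (plane_map u v z) w ^+ 2 = r ^+ 2 / dot z z.
    by rewrite /lnorm1 yy yw; field; rewrite gt_eqF.
  split; last by rewrite l2 ler_pdivrMr // mul1r.
  have -> : dot (dir1 (plane_map u v z) w) (dir1 (plane_map u v z) w) =
      expR (- lnorm (plane_map u v z)) ^+ 2 * (1 - r ^+ 2 / dot z z).
    rewrite /dir1 dotZl dotZr dotBl !dotBr !dotZl !dotZr (dotC w) ww yw yy /lnorm1 yw yy.
    by field; rewrite gt_eqF.
  by rewrite mulrA [dot z z * _]mulrC e mul1r gerBl divr_ge0 ?sqr_ge0 // ltW.
by split; apply: gen; rewrite ?uu ?vv ?yu ?yv // dot_plane -!expr2 ?lerDl ?lerDr sqr_ge0.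
Qed.
End LinearMaps.

Section LinearDerivatives.
Variables (R : realType) (n : nat).
Implicit Types (u v : 'rV[R]_(n.*2)) (w z : 'rV[R]_(1.*2)).

Lemma is_derive_of_line (V W : normedModType R) (f : V -> W) (x w : V) (d : W) :
  is_derive (0 : R) 1 (fun h => f (h *: w + x)) d -> is_derive x w f d.
Proof.
have e : (fun h : R => h^-1 *: (((fun h => f (h *: w + x)) \o shift 0) (h *: 1)
    - f (0 *: w + x)))
  = (fun h : R => h^-1 *: ((f \o shift x) (h *: w) - f x)).
  by apply/funext => h /=; rewrite addr0 [h *: 1]mulr1 scale0r add0r.
by move=> [d1 d2]; apply: DeriveDef; move: d1 d2; rewrite /derivable /derive e.
Qed.

Lemma is_derive_plane_map u v z w :
  is_derive z w (plane_map u v) (plane_map u v w).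
Proof.
apply: is_derive_of_line.
have h : is_derive (0 : R) 1 (fun h : R => h *: plane_map u v w + plane_map u v z)
    (1 *: plane_map u v w + (0 : R) *: 0 + 0).
  exact: (is_derive_curve_add (is_derive_curve_scale (is_derive_id (0 : R) 1)
    (is_derive_cst (plane_map u v w) _ _)) (is_derive_cst (plane_map u v z) _ _)).
apply: is_derive_eq (near_eq_is_derive _ h) _; last by rewrite scale1r scaler0 !addr0.
by near=> s; rewrite /plane_map !mxE; apply/rowP => i; rewrite !mxE; ring.
Unshelve. all: by end_near. Qed.

(** The iterated derivatives of a linear map are the map itself, then its value at the direction,
    then zero, written here as its value at 0. Thus all of them are the same linear map composed
    with a change of argument. *)
Definition iter_arg (vs : seq 'rV[R]_(1.*2)) z :=
  match vs with [::] => z | [:: w] => w | _ => 0 end.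

Lemma iter_derive_plane_map vs u v :
  iter_derive vs (plane_map u v) = plane_map u v \o iter_arg vs.
Proof.
elim: vs => [//|w vs IH] /=; rewrite -/(iter_derive vs _) IH; apply/funext => z /=.
case: vs {IH} => [|w' vs] /=.
  by rewrite (@derive_val _ _ _ _ _ _ _ (is_derive_plane_map u v z w)).
have -> : plane_map u v \o iter_arg (w' :: vs) = cst (plane_map u v (iter_arg (w' :: vs) 0)).
  by apply/funext => y /=; case: vs.
by rewrite derive_cst /plane_map !mxE !scale0r addr0.
Qed.

Lemma smooth_plane_map (U : set 'rV[R]_(1.*2)) u v : smooth_on U (plane_map u v).
Proof.
move=> vs x _; rewrite iter_derive_plane_map; case: vs => [|w vs].
  split=> [y|]; first by have [] := is_derive_plane_map u v x y.
  have cc : {for x, continuous (plane_map u v)}.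
    have ce i : {for x, continuous (fun y : 'rV[R]_(1.*2) => y 0 i : R)}.
      exact: coord_continuous.
    have cz i (w : 'rV[R]_(n.*2)) : {for x, continuous (fun y : 'rV[R]_(1.*2) => y 0 i *: w : 'rV[R]_(n.*2))}.
      exact: cvgZr_tmp (ce i).
    exact: (cvgD (cz i0 u) (cz i1 v)).
  exact: cc.
have -> : plane_map u v \o iter_arg (w :: vs) = cst (plane_map u v (iter_arg (w :: vs) 0)).
  by apply/funext => y /=; case: vs.
by split=> [y|]; [exact: derivable_cst | exact: cst_continuous].
Qed.
End LinearDerivatives.

Section PolynomialFlows.
Variable R : realType.
Local Notation V := (R^o * 'rV[R]_(1.*2))%type.
Variables (A B : R -> R) (a0 b0 : R).
Let slope t := a0 * A t ^+ 2 - b0 * B t ^+ 2.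
Hypothesis dA : forall t : R, is_derive t 1 A (A t * (2 - 2 * slope t)).
Hypothesis dB : forall t : R, is_derive t 1 B (B t * (- 2 - 2 * slope t)).

(* The ring generated by [A], [B] and the coordinates of the plane is stable
   under differentiation, because the derivatives of [A] and [B] are
   polynomials in [A] and [B]; so all its elements are smooth. *)
Inductive pexpr : Type :=
  | PConst of R | PA | PB | PCoord of 'I_(1.*2)
  | PAdd of pexpr & pexpr | PMul of pexpr & pexpr.

Fixpoint peval e (p : V) : R :=
  match e with
  | PConst c => c | PA => A p.1 | PB => B p.1 | PCoord i => p.2 0 i
  | PAdd e1 e2 => peval e1 p + peval e2 p
  | PMul e1 e2 => peval e1 p * peval e2 p
  end.

Definition pslope := PAdd (PMul (PConst a0) (PMul PA PA))
                          (PMul (PConst (- b0)) (PMul PB PB)).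

Fixpoint pderive (w : V) e : pexpr :=
  match e with
  | PConst c => PConst 0
  | PA => PMul (PConst w.1) (PMul PA (PAdd (PConst 2) (PMul (PConst (- 2)) pslope)))
  | PB => PMul (PConst w.1) (PMul PB (PAdd (PConst (- 2)) (PMul (PConst (- 2)) pslope)))
  | PCoord i => PConst (w.2 0 i)
  | PAdd e1 e2 => PAdd (pderive w e1) (pderive w e2)
  | PMul e1 e2 => PAdd (PMul (pderive w e1) e2) (PMul e1 (pderive w e2))
  end.

Lemma is_derive_peval_line e (p w : V) :
  is_derive (0 : R) 1 (fun h : R => peval e (h *: w + p)) (peval (pderive w e) p).
Proof.
have p0 : (0 : R) *: w + p = p by rewrite scale0r add0r.
have affine (a b : R) : is_derive (0 : R) 1 (fun h : R => h * a + b) a.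
  apply: is_derive_eq (is_derive_add (is_derive_mul (is_derive_id (0 : R) 1)
    (is_derive_cst a _ _)) (is_derive_cst b _ _)) _.
  by rewrite mul1r mulr0 !addr0.
have z1 (t s : R) : (0 : R) * t + s = s by rewrite mul0r add0r.
elim: e => [c| | |i|e1 h1 e2 h2|e1 h1 e2 h2] /=.
- exact: is_derive_cst.
- apply: is_derive_eq (is_derive_comp (dA _) (affine w.1 p.1)) _.
  by rewrite z1 /slope; ring.
- apply: is_derive_eq (is_derive_comp (dB _) (affine w.1 p.1)) _.
  by rewrite z1 /slope; ring.
- apply: near_eq_is_derive (affine (w.2 0 i) (p.2 0 i)).
  by near=> h; rewrite !mxE.
- exact: is_derive_add.
- by apply: is_derive_eq (is_derive_mul h1 h2) _; rewrite p0.
Unshelve. all: by end_near. Qed.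

Lemma continuous_peval e : continuous (peval e).
Proof.
have cAB (f df : R -> R) : (forall t : R, is_derive t 1 f (df t)) ->
    continuous (fun p : V => f p.1).
  move=> hf p; apply: (@continuous_comp _ _ _ (fun p : V => p.1 : R) f).
    exact: cvg_fst.
  by apply: differentiable_continuous; apply/derivable1_diffP; have [] := hf p.1.
elim: e => [c| | |i|e1 h1 e2 h2|e1 h1 e2 h2] p /=.
- exact: cvg_cst.
- exact: (cAB _ _ dA).
- exact: (cAB _ _ dB).
- apply: (@cvg_entry R V _ p (fun q : V => q.2)); exact: cvg_snd.
- by apply: cvgD; [exact: h1 | exact: h2].
- by apply: cvgM; [exact: h1 | exact: h2].
Qed.

Variable n : nat.

Definition pvec (E : 'I_n -> pexpr) (p : V) : 'rV[R]_n := \row_i peval (E i) p.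

Lemma is_derive_pvec E (p w : V) :
  is_derive p w (pvec E) (pvec (fun i => pderive w (E i)) p).
Proof.
apply: is_derive_of_line; apply: is_derive_rV => i; rewrite mxE.
apply: near_eq_is_derive (is_derive_peval_line (E i) p w).
by near=> h; rewrite mxE.
Unshelve. all: by end_near. Qed.

Lemma derive_pvec E (w : V) : 'D_w (pvec E) = pvec (fun i => pderive w (E i)).
Proof. by apply/funext => p; have [] := is_derive_pvec E p w. Qed.

Lemma iter_derive_pvec vs E : exists E', iter_derive vs (pvec E) = pvec E'.
Proof.
elim: vs => [|w vs [E' IH]]; first by exists E.
by exists (fun i => pderive w (E' i)); rewrite /= -/(iter_derive vs _) IH derive_pvec.
Qed.

Lemma smooth_pvec (U : set V) E : smooth_on U (pvec E).
Proof.
move=> vs p _; have [E' ->] := iter_derive_pvec vs E.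
split=> [w|]; first by have [] := is_derive_pvec E' p w.
have -> : pvec E' = fun q => \sum_i peval (E' i) q *: delta_mx 0 i.
  by apply/funext => q; rewrite [LHS]row_sum_delta; apply: eq_bigr => i _; rewrite mxE.
apply: cvg_big => [|i _]; first exact: add_continuous.
exact: cvgZr_tmp (@continuous_peval (E' i) p).
Qed.
End PolynomialFlows.

Section Frames.
Variables (R : realType) (n : nat) (p q : 'rV[R]_(n.*2)).
Hypotheses (pq0 : dot p q = 0) (pJq0 : dot (p *m Jmx R n) q = 0).
Local Notation J := (Jmx R n).

(** With (x^1, x^2) read as a complex number z, the map x^1 [frame1] + x^2 [frame2] is z (A p) +
    conj z (B q): the linear part is scaled by A and the antilinear part by B. *)
Definition frame1 (A B : R) := A *: p + B *: q.
Definition frame2 (A B : R) := A *: (p *m J) - B *: (q *m J).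

Lemma frame1J A B : frame1 A B *m J = A *: (p *m J) + B *: (q *m J).
Proof. by rewrite /frame1 mulmxDl -!scalemxAl. Qed.

Lemma frame2J A B : frame2 A B *m J = - (A *: p - B *: q).
Proof. by rewrite /frame2 mulmxBl -!scalemxAl !mulmx_JJ !scalerN opprB opprK addrC. Qed.

Lemma dot_qp : dot q p = 0. Proof. by rewrite dotC pq0. Qed.

Lemma dot_cross : [/\ dot p (q *m J) = 0, dot q (p *m J) = 0,
  dot (p *m J) q = 0 & dot (q *m J) p = 0].
Proof.
have h := pJq0; have h' : dot p (q *m J) = 0.
  by have := dot_J p q; rewrite h => /eqP; rewrite eq_sym oppr_eq0 => /eqP.
by split=> //; rewrite dotC.
Qed.

Lemma frame_orthonormal A B : dot p p * A ^+ 2 + dot q q * B ^+ 2 = 1 ->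
  orthonormal_pair (frame1 A B) (frame2 A B).
Proof.
move=> AB; have [c1 c2 c3 c4] := dot_cross.
have pJp : dot p (p *m J) = 0 by rewrite dotC dot_J_id.
have qJq : dot q (q *m J) = 0 by rewrite dotC dot_J_id.
split; rewrite /frame1 /frame2 ?(dotDl, dotDr, dotBl, dotBr, dotNl, dotNr, dotZl, dotZr).
- by rewrite pq0 dot_qp -AB; ring.
- by rewrite !dot_JJ pq0 dot_qp -AB; ring.
- by rewrite c1 c2 pJp qJq; ring.
Qed.

Lemma frame_slope A B :
  dot (frame1 A B *m J) (frame2 A B) = dot p p * A ^+ 2 - dot q q * B ^+ 2.
Proof.
rewrite frame1J /frame2 ?(dotDl, dotDr, dotBl, dotBr, dotNl, dotNr, dotZl, dotZr).
by rewrite !dot_JJ pq0 dot_qp; ring.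
Qed.

End Frames.

Section ExplicitSolution.
Variables (R : realType) (n : nat) (u0 v0 : 'rV[R]_(n.*2)).
Hypothesis o0 : orthonormal_pair u0 v0.
Local Notation J := (Jmx R n).
Local Notation V := (R^o * 'rV[R]_(1.*2))%type.

(* The complex linear and antilinear parts of [plane_map u0 v0]. *)
Definition hol_part := 2^-1 *: (u0 - v0 *m J).
Definition anti_part := 2^-1 *: (u0 + v0 *m J).
Local Notation p := hol_part.
Local Notation q := anti_part.
Let a0 := dot p p.
Let b0 := dot q q.

Lemma hol_anti_norm : a0 + b0 = 1.
Proof.
have [uu vv uv] := o0; rewrite /a0 /b0 /p /q !dotE !dot_JJ uu vv.
by field.
Qed.

(** The parts of an orthonormal pair are Hermitian orthogonal: |u0| = |v0| gives this equation, and
    <u0, v0> = 0 gives the next one. *)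
Lemma dot_hol_anti : dot p q = 0.
Proof.
have [uu vv uv] := o0; rewrite /p /q !dotE !dot_JJ uu vv (dotC (v0 *m J)).
by field.
Qed.

Lemma dot_holJ_anti : dot (p *m J) q = 0.
Proof.
have [uu vv uv] := o0.
rewrite /p /q -scalemxAl mulmxBl mulmx_JJ opprK !dotE dot_JJ !dot_J_id.
by rewrite (dotC v0 (v0 *m J)) dot_J_id uv (dotC v0) uv; field.
Qed.

(** The solution is A = exp (2 t) / sqrt N and B = exp (- 2 t) / sqrt N, with N fixed by the
    normalisation |p|^2 A^2 + |q|^2 B^2 = 1. Half the logarithm of N is a primitive of 2 a, which is
    why A and B are written as exponentials. *)
Definition solN t := a0 * expR (4 * t) + b0 * expR (- (4 * t)).
Definition solA t := expR (2 * t - 2^-1 * ln (solN t)).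
Definition solB t := expR (- (2 * t) - 2^-1 * ln (solN t)).

Lemma solN_gt0 t : 0 < solN t.
Proof.
have a1 : 0 <= a0 by exact: dot_ge0.
have b1 : 0 <= b0 by exact: dot_ge0.
have := hol_anti_norm; have [e1 e2] := (expR_gt0 (4 * t), expR_gt0 (- (4 * t))).
rewrite /solN; have [->|a1'] := eqVneq a0 0.
  by rewrite add0r mul0r add0r => ->; rewrite mul1r.
by move=> _; rewrite ltr_pwDl ?mulr_gt0 // ?lt_def ?a1' ?a1 // mulr_ge0 // ltW.
Qed.

Lemma solA2 t : solA t ^+ 2 = expR (4 * t) / solN t.
Proof.
rewrite expr2 -expRD -[solN t in RHS]lnK ?posrE ?solN_gt0 // -expRB.
by congr expR; field.
Qed.

Lemma solB2 t : solB t ^+ 2 = expR (- (4 * t)) / solN t.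
Proof.
rewrite expr2 -expRD -[solN t in RHS]lnK ?posrE ?solN_gt0 // -expRB.
by congr expR; field.
Qed.

Lemma sol_normalized t : a0 * solA t ^+ 2 + b0 * solB t ^+ 2 = 1.
Proof.
have n0 : solN t != 0 by rewrite gt_eqF ?solN_gt0.
by rewrite solA2 solB2 !mulrA -mulrDl -/(solN t) divff.
Qed.

Let slope t := a0 * solA t ^+ 2 - b0 * solB t ^+ 2.

Lemma is_derive_ln_solN (t : R) :
  is_derive t 1 (fun s => 2^-1 * ln (solN s)) (2 * slope t).
Proof.
have lin (c : R) : is_derive t 1 (fun s : R => c * s) c.
  by apply: is_derive_eq (is_derive_cmul c (is_derive_id t 1)) _; rewrite mulr1.
have nlin : is_derive t 1 (fun s : R => - (4 * s)) (- 4) := is_derive_opp (lin 4).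
have hN : is_derive t 1 solN _ := is_derive_add
  (is_derive_cmul a0 (is_derive_comp (is_derive_expR _) (lin 4)))
  (is_derive_cmul b0 (is_derive_comp (is_derive_expR _) nlin)).
apply: is_derive_eq (is_derive_cmul 2^-1
  (is_derive_comp (is_derive1_ln (solN_gt0 t)) hN)) _.
rewrite /slope solA2 solB2; field.
by rewrite gt_eqF ?solN_gt0.
Qed.

Lemma is_derive_solA (t : R) : is_derive t 1 solA (solA t * (2 - 2 * slope t)).
Proof.
have lin (c : R) : is_derive t 1 (fun s : R => c * s) c.
  by apply: is_derive_eq (is_derive_cmul c (is_derive_id t 1)) _; rewrite mulr1.
exact: (is_derive_comp (is_derive_expR _) (is_derive_sub (lin 2) (is_derive_ln_solN t))).
Qed.

Lemma is_derive_solB (t : R) : is_derive t 1 solB (solB t * (- 2 - 2 * slope t)).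
Proof.
have lin (c : R) : is_derive t 1 (fun s : R => c * s) c.
  by apply: is_derive_eq (is_derive_cmul c (is_derive_id t 1)) _; rewrite mulr1.
exact: (is_derive_comp (is_derive_expR _)
  (is_derive_sub (is_derive_opp (lin 2)) (is_derive_ln_solN t))).
Qed.

Lemma sol0 : solA 0 = 1 /\ solB 0 = 1.
Proof.
by rewrite /solA /solB /solN !mulr0 oppr0 expR0 !mulr1 hol_anti_norm ln1 mulr0 subr0 expR0.
Qed.

Lemma frame_init : frame1 p q 1 1 = u0 /\ frame2 p q 1 1 = v0.
Proof.
split; rewrite /frame1 /frame2 !scale1r /p /q.
  by apply/rowP => i; rewrite !mxE; field.
rewrite -!scalemxAl mulmxBl mulmxDl !mulmx_JJ.
by move: (u0 *m J) => w; apply/rowP => i; rewrite !mxE; field.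
Qed.

Definition sol_expr (i : 'I_(n.*2)) : pexpr R :=
  PAdd (PMul (PCoord _ i0)
         (PAdd (PMul (PA _) (PConst (p 0 i))) (PMul (PB _) (PConst (q 0 i)))))
       (PMul (PCoord _ i1)
         (PAdd (PMul (PA _) (PConst ((p *m J) 0 i)))
               (PMul (PB _) (PConst (- (q *m J) 0 i))))).

Definition sol : V -> 'rV[R]_(n.*2) := pvec solA solB sol_expr.

Lemma solE t z : sol (t, z) =
  plane_map (frame1 p q (solA t) (solB t)) (frame2 p q (solA t) (solB t)) z.
Proof.
rewrite /plane_map /frame1 /frame2; apply/rowP => i; rewrite mxE /=.
by move: (p *m J) (q *m J) => pJ qJ; rewrite !mxE; ring.
Qed.

Lemma sol_smooth U : smooth_on U sol.
Proof. exact: smooth_pvec is_derive_solA is_derive_solB _ _ _. Qed.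

Lemma derive_sol w : 'D_w sol = pvec solA solB (fun i => pderive a0 b0 w (sol_expr i)).
Proof. exact: derive_pvec is_derive_solA is_derive_solB _ _ _. Qed.

Lemma derive_solE w pt :
  'D_w sol pt = pvec solA solB (fun i => pderive a0 b0 w (sol_expr i)) pt.
Proof. by have := congr1 (fun f => f pt) (derive_sol w). Qed.

Lemma sol_space1 t z : ('D_(space_dir R i0) sol (t, z) = frame1 p q (solA t) (solB t)) *
  ('D_(space_dir R i1) sol (t, z) = frame2 p q (solA t) (solB t)).
Proof.
rewrite !derive_solE /frame1 /frame2; split; apply/rowP => i; rewrite mxE /=.
  by move: (p *m J) (q *m J) => pJ qJ; rewrite !mxE !idxE !eqxx /=; ring.
by move: (p *m J) (q *m J) => pJ qJ; rewrite !mxE !idxE !eqxx /=; ring.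
Qed.

Lemma sol_space2 t z a : 'D_(space_dir R a) ('D_(space_dir R a) sol) (t, z) = 0.
Proof.
rewrite derive_sol.
have := congr1 (fun f => f (t, z)) (derive_pvec is_derive_solA is_derive_solB
  (fun i => pderive a0 b0 (space_dir R a) (sol_expr i)) (space_dir R a)).
move=> /= ->; apply/rowP => i; rewrite mxE /=.
by move: (p *m J) (q *m J) => pJ qJ; rewrite !mxE; ring.
Qed.

Lemma sol_flow t z : z != 0 -> 'D_(1, 0) sol (t, z) = flow_rhs_at sol (t, z).
Proof.
move=> z0; rewrite (flow_rhs_at_eq (solE t z) (sol_space1 t z).1 (sol_space1 t z).2
  (sol_space2 t z i0) (sol_space2 t z i1)) [(t, z).2]/=.
rewrite (plane_flow_rhs
  (frame_orthonormal dot_hol_anti dot_holJ_anti (sol_normalized t)) z0).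
rewrite (frame_slope dot_hol_anti) -/a0 -/b0 frame1J frame2J /plane_map /frame1 /frame2.
rewrite derive_solE; apply/rowP => i; rewrite mxE /=.
by move: (p *m J) (q *m J) => pJ qJ; rewrite !mxE; ring.
Qed.

Lemma sol_gradient t z a : z != 0 -> unit_gradient sol (t, z) a.
Proof.
move=> z0; have [h1 h2] := plane_unit_gradient (frame_orthonormal dot_hol_anti dot_holJ_anti (sol_normalized t)) z0.
move: a; apply: re_im_ind => j; rewrite ord1 /unit_gradient.
  by rewrite (sol_space1 t z).1 solE.
by rewrite (sol_space1 t z).2 solE.
Qed.
End ExplicitSolution.

(** * Long-time limit and uniform convergence *)

Section Asymptotics.
Variables (R : realType) (n : nat) (u0 v0 : 'rV[R]_(n.*2)).
Hypothesis o0 : orthonormal_pair u0 v0.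
Local Notation J := (Jmx R n).
Local Notation p := (hol_part u0 v0).
Local Notation q := (anti_part u0 v0).
Local Notation A := (solA u0 v0).
Local Notation B := (solB u0 v0).

(** The square of B is even at most exp (- 8 t) / |p|^2; the harmonic sequence merely serves as a
    convenient null sequence. *)
Lemma solB2_le (k : nat) : dot p p != 0 -> B k%:R ^+ 2 <= (dot p p)^-1 * harmonic k.
Proof.
move=> a0; have a1 : 0 < dot p p by rewrite lt_def a0 dot_ge0.
have N0 := solN_gt0 o0 k%:R.
rewrite solB2 // expRN -invfM /harmonic -invfM lef_pV2 ?posrE ?mulr_gt0 ?expR_gt0 //.
have e1 : k.+1%:R <= expR (4 * k%:R) :> R.
  apply: le_trans (expR_ge1Dx _); rewrite -natrM -nat1r lerD2l ler_nat.
  by rewrite leq_pmull.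
have e2 : 1 <= expR (4 * k%:R) :> R by apply: le_trans e1; rewrite ler1n.
apply: (@le_trans _ _ (solN u0 v0 k%:R)); last by rewrite ler_peMl // ltW.
rewrite /solN (@le_trans _ _ (dot p p * expR (4 * k%:R))) ?ler_wpM2l ?dot_ge0 //.
by rewrite lerDl mulr_ge0 ?dot_ge0 ?expR_ge0.
Qed.

(** If p = 0, the normalisation forces B = 1 for all times and the antilinear map is stationary.
    Otherwise B tends to 0, and the normalisation, which expresses A through B, makes A tend to 1 /
    |p|. *)
Lemma sol_limit : exists a b : R,
  [/\ dot p p * a ^+ 2 + dot q q * b ^+ 2 = 1,
      a = 0 \/ b = 0,
      frame1 p q (A k%:R) (B k%:R) @[k --> \oo] --> frame1 p q a b
    & frame2 p q (A k%:R) (B k%:R) @[k --> \oo] --> frame2 p q a b].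
Proof.
have ab := hol_anti_norm o0; have norm t := sol_normalized o0 t.
have [p0|a0] := eqVneq (dot p p) 0.
  have pE : p = 0 by apply/eqP; rewrite -dot_eq0 p0.
  have b1 : dot q q = 1 by rewrite -ab p0 add0r.
  have B1 t : B t = 1.
    have /eqP := norm t; rewrite p0 b1 mul0r add0r mul1r sqrf_eq1 => /orP[/eqP//|/eqP e].
    by have := expR_gt0 (- (2 * t) - 2^-1 * ln (solN u0 v0 t)); rewrite -/(B t) e ltr0N1.
  exists 0, 1; split; first by rewrite p0 b1 expr1n mul0r mulr1 add0r.
  - by left.
  - by rewrite /frame1 pE; under eq_fun do rewrite B1 !scaler0; rewrite scaler0; exact: cvg_cst.
  - rewrite /frame2 pE mul0mx; under eq_fun do rewrite B1 !scaler0; rewrite scaler0.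
    exact: cvg_cst.
have a1 : 0 < dot p p by rewrite lt_def a0 dot_ge0.
have cB2 : B k%:R ^+ 2 @[k --> \oo] --> (0 : R).
  apply: (@squeeze_cvgr _ _ _ _ (fun=> 0) (fun k => (dot p p)^-1 * harmonic k)).
  - by near=> k; rewrite sqr_ge0 solB2_le.
  - exact: cvg_cst.
  - by rewrite -[X in _ --> X](mulr0 (dot p p)^-1); apply: cvgMl_tmp; exact: cvg_harmonic.
have B0 t : 0 <= B t by exact: expR_ge0.
have A0 t : 0 <= A t by exact: expR_ge0.
have cB : B k%:R @[k --> \oo] --> (0 : R).
  have -> : (fun k : nat => B k%:R) = (fun k => Num.sqrt (B k%:R ^+ 2)).
    by apply/funext => k; rewrite sqrtr_sqr ger0_norm.
  rewrite -[X in _ --> X](@sqrtr0 R).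
  exact: (@continuous_cvg _ _ _ _ _ _ Num.sqrt _ (@sqrt_continuous R 0) cB2).
have cA : A k%:R @[k --> \oo] --> Num.sqrt ((dot p p)^-1 * (1 - dot q q * 0)).
  have -> : (fun k : nat => A k%:R) =
      (fun k => Num.sqrt ((dot p p)^-1 * (1 - dot q q * B k%:R ^+ 2))).
    have e t : (dot p p)^-1 * (1 - dot q q * B t ^+ 2) = A t ^+ 2.
      by apply: (mulfI a0); rewrite mulVKf //; have := norm t; lra.
    by apply/funext => k; rewrite e sqrtr_sqr ger0_norm.
  apply: (@continuous_cvg _ _ _ _ _ _ Num.sqrt); first exact: sqrt_continuous.
  apply: cvgMl_tmp; apply: cvgB; first exact: cvg_cst.
  exact: cvgMl_tmp.
rewrite mulr0 subr0 mulr1 in cA.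
exists (Num.sqrt (dot p p)^-1), 0; split.
- by rewrite sqr_sqrtr ?invr_ge0 ?dot_ge0 // divff // expr0n mulr0 addr0.
- by right.
- by rewrite /frame1; apply: cvgD; apply: cvgZr_tmp.
- by rewrite /frame2; apply: cvgB; apply: cvgZr_tmp.
Unshelve. all: by end_near. Qed.
End Asymptotics.

Section UniformConvergence.
Variables (R : realType) (n : nat).
Implicit Types (U : set 'rV[R]_(1.*2)).

Lemma plane_map_uniform_cvg U (us vs : nat -> 'rV[R]_(n.*2))
    (u v : 'rV[R]_(n.*2)) (M : R) :
  us @ \oo --> u -> vs @ \oo --> v ->
  (forall z, U z -> `|z 0 i0| <= M /\ `|z 0 i1| <= M) ->
  {uniform U, (fun k => plane_map (us k) (vs k)) @ \oo --> plane_map u v}.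
Proof.
move=> cu cv hM P /uniform_nbhs[E [entE subP]]; apply: filterS subP _.
move: entE; rewrite -entourage_ballE => -[e /= e0 he].
(* The bound M itself may fail to be positive, for instance when U is empty. *)
pose M1 := `|M| + 1; have M10 : 0 < M1 by rewrite ltr_pwDr.
have d0 : 0 < e / (2 * M1) by rewrite divr_gt0 // mulr_gt0.
have hu := (cvgrPdist_lt _ _).1 cu _ d0; have hv := (cvgrPdist_lt _ _).1 cv _ d0.
near=> k => z Uz; apply: he; rewrite /= -ball_normE /= /ball_ /=.
have -> : plane_map u v z - plane_map (us k) (vs k) z
  = z 0 i0 *: (u - us k) + z 0 i1 *: (v - vs k).
  by rewrite /plane_map; apply/rowP => i; rewrite !mxE; ring.
have [z1 z2] := hM _ Uz.
have zM (x : R) : `|x| <= M -> `|x| <= M1.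
  by move=> h; rewrite (le_trans h) // (le_trans (ler_norm _)) // lerDl.
apply: le_lt_trans (ler_normD _ _) _; rewrite !normrZ [ltRHS]splitr ltrD //.
  apply: (@le_lt_trans _ _ (M1 * `|u - us k|)); first by rewrite ler_wpM2r // zM.
  rewrite -ltr_pdivlMl //; have -> : M1^-1 * (e / 2) = e / (2 * M1).
    by field; rewrite gt_eqF.
  by near: k; exact: hu.
apply: (@le_lt_trans _ _ (M1 * `|v - vs k|)); first by rewrite ler_wpM2r // zM.
rewrite -ltr_pdivlMl //; have -> : M1^-1 * (e / 2) = e / (2 * M1).
  by field; rewrite gt_eqF.
by near: k; exact: hv.
Unshelve. all: by end_near. Qed.

(** By [iter_derive_plane_map], convergence of a derivative on U is convergence of the maps
    themselves on the image of U under [iter_arg ws], which is again bounded. *)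
Lemma iter_plane_map_uniform_cvg U (us vs : nat -> 'rV[R]_(n.*2))
    (u v : 'rV[R]_(n.*2)) (M : R) ws :
  us @ \oo --> u -> vs @ \oo --> v ->
  (forall z, U z -> `|z 0 i0| <= M /\ `|z 0 i1| <= M) ->
  {uniform U, (fun k => iter_derive ws (plane_map (us k) (vs k))) @ \oo
              --> iter_derive ws (plane_map u v)}.
Proof.
move=> cu cv hM P /uniform_nbhs[E [entE subP]].
pose M' := Num.max (Num.max `|M| `|head 0 ws 0 i0|) `|head 0 ws 0 i1|.
have arg_bd z : (iter_arg ws @` U) z -> `|z 0 i0| <= M' /\ `|z 0 i1| <= M'.
  move=> [y Uy <-]; have [y1 y2] := hM _ Uy.
  have yM (x : R) : `|x| <= M -> `|x| <= M'.
    by move=> h; rewrite !le_max (le_trans h (ler_norm _)).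
  clear P subP; case: ws @M' yM => [|w [|w' ws]] M' yM /=; first by split; exact: yM.
    by rewrite !le_max !lexx ?orbT.
  by rewrite !mxE normr0 !le_max normr_ge0.
have := plane_map_uniform_cvg cu cv arg_bd.
move=> /(_ [set h | forall y, (iter_arg ws @` U) y -> E (plane_map u v y, h y)]).
have : nbhs (plane_map u v : {uniform` iter_arg ws @` U -> 'rV[R]_(n.*2)})
    [set h | forall y, (iter_arg ws @` U) y -> E (plane_map u v y, h y)].
  by apply/uniform_nbhs; exists E; split.
move=> hn /(_ hn) hk.
have {}hk : \forall k \near \oo, forall y, (iter_arg ws @` U) y ->
  E (plane_map u v y, plane_map (us k) (vs k) y) := hk.
suff : \forall k \near \oo, P (iter_derive ws (plane_map (us k) (vs k))) by [].
apply: filterS hk => k hk; apply: subP => y Uy.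
by rewrite !iter_derive_plane_map /=; apply: hk; exists y.
Qed.
End UniformConvergence.

(** * The theorem *)

Section InducedMaps.
Variables (R : realType) (alpha : R) (m n : nat).
Hypothesis alpha1 : 1 < alpha.

Lemma hopf_map_exists (G : 'rV[R]_(m.*2) -> 'rV[R]_(n.*2)) :
  (forall z, z != 0 -> G z != 0) ->
  (forall (k : int) z, G (alpha ^ k *: z) = alpha ^ k *: G z) ->
  exists f : hopf alpha m -> hopf alpha n, forall z, z != 0 -> lifts_at f G z.
Proof.
move=> G0 Gs; exists (fun x => hopf_pi alpha (G0 _ (valP (repr x)))) => z z0.
exists z0, (G0 _ z0); apply/hopf_pi_eqP.
case: (repr _) (reprK (hopf_pi alpha z0)) => x x0 e /=.
have /hopf_pi_eqP[k ->] : hopf_pi alpha x0 = hopf_pi alpha z0 := e.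
by exists k.
Qed.

Lemma lifts_ext (f f' : hopf alpha m -> hopf alpha n) (G : 'rV[R]_(m.*2) -> 'rV[R]_(n.*2)) :
  (forall z, z != 0 -> lifts_at f G z) -> (forall z, z != 0 -> lifts_at f' G z) ->
  f = f'.
Proof.
move=> hf hf'; apply/funext => x; have [z [z0 ->]] := hopf_piP x.
have [z1 [y1 e1]] := hf z z0; have [z2 [y2 e2]] := hf' z z0.
rewrite (Prop_irrelevance z1 z0) in e1; rewrite (Prop_irrelevance z2 z0) in e2.
by rewrite e1 e2 (Prop_irrelevance y1 y2).
Qed.
End InducedMaps.

Section HolomorphicLimits.
Variables (R : realType) (n : nat).
Implicit Types (u v : 'rV[R]_(n.*2)) (z X : 'rV[R]_(1.*2)).
Local Notation J := (Jmx R n).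

Lemma derive_plane_map u v z X : 'D_X (plane_map u v) z = plane_map u v X.
Proof. by have [] := is_derive_plane_map u v z X. Qed.

Lemma plane_map_holomorphic u X :
  plane_map u (u *m J) X *m J = plane_map u (u *m J) (X *m Jmx R 1).
Proof.
rewrite /plane_map mulmxDl -!scalemxAl mulmx_JJ mulmx_J_re mulmx_J_im.
by rewrite scalerN scaleNr addrC.
Qed.

Lemma plane_map_antiholomorphic u X :
  plane_map u (- (u *m J)) X *m J = - plane_map u (- (u *m J)) (X *m Jmx R 1).
Proof.
rewrite /plane_map mulmxDl -!scalemxAl mulNmx mulmx_JJ opprK mulmx_J_re mulmx_J_im.
by rewrite scalerN scaleNr opprD !opprK addrC.
Qed.
End HolomorphicLimits.

Section MainProof.
Variables (R : realType) (alpha : R).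
Hypothesis alpha1 : 1 < alpha.
Local Notation V := (R^o * 'rV[R]_(1.*2))%type.
Variables u0 v0 : 'rV[R]_(2.*2).
Hypothesis o0 : orthonormal_pair u0 v0.
Variable f0 : torus alpha -> hopf_surface alpha.
Hypothesis f0E : forall z, z != 0 -> lifts_at f0 (plane_map u0 v0) z.
Local Notation p := (hol_part u0 v0).
Local Notation q := (anti_part u0 v0).
Local Notation frame_u t := (frame1 p q (solA u0 v0 t) (solB u0 v0 t)).
Local Notation frame_v t := (frame2 p q (solA u0 v0 t) (solB u0 v0 t)).

Lemma frame_pair t : orthonormal_pair (frame_u t) (frame_v t).
Proof.
exact: (frame_orthonormal (dot_hol_anti o0) (dot_holJ_anti o0) (sol_normalized o0 t)).
Qed.

Lemma sol_neq0 t z : z != 0 -> sol u0 v0 (t, z) != 0.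
Proof. by move=> z0; rewrite solE; apply: plane_map_neq0 => //; exact: frame_pair. Qed.

Lemma sol_scale t z (k : int) :
  sol u0 v0 (t, alpha ^ k *: z) = alpha ^ k *: sol u0 v0 (t, z).
Proof. by rewrite !solE plane_map_scale. Qed.

Lemma sol_init z : sol u0 v0 (0, z) = plane_map u0 v0 z.
Proof.
have [a1 b1] := sol0 o0; have [e1 e2] := frame_init u0 v0.
by rewrite solE a1 b1 e1 e2.
Qed.

Lemma sol_initial_lift f z : f = f0 -> z != 0 ->
  lifts_at f (fun y => sol u0 v0 (0, y)) z.
Proof.
move=> -> z0; have -> : (fun y => sol u0 v0 (0, y)) = plane_map u0 v0.
  by apply/funext => y; exact: sol_init.
exact: f0E.
Qed.

Lemma flow_explicit T (f : R -> torus alpha -> hopf_surface alpha) t z :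
  dbar_flow T f -> f 0 = f0 -> 0 <= t -> (t%:E < T)%E -> z != 0 ->
  lifts_at (f t) (plane_map (frame_u t) (frame_v t)) z.
Proof.
move=> flow f00 t0 tT z0.
have -> : plane_map (frame_u t) (frame_v t) = (fun y => sol u0 v0 (t, y)).
  by apply/funext => y; rewrite solE.
apply: (@flow_unique R alpha alpha1 T f (sol u0 v0) flow) => //.
- exact: sol_smooth.
- exact: sol_neq0.
- by move=> s y; exact: sol_flow.
- by move=> s y a; exact: sol_gradient.
- exact: sol_scale.
- by move=> y; exact: sol_initial_lift.
Qed.

Lemma flow_exists : exists f : R -> torus alpha -> hopf_surface alpha,
  dbar_flow +oo%E f /\ f 0 = f0.
Proof.
have ex t := @hopf_map_exists R alpha 1 2 (fun y => sol u0 v0 (t, y))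
  (@sol_neq0 t) (fun k z => sol_scale t z k).
pose f t := sval (cid (ex t)).
have hf t z : z != 0 -> lifts_at (f t) (fun y => sol u0 v0 (t, y)) z.
  exact: (svalP (cid (ex t))).
exists f; split; last first.
  by apply: lifts_ext (hf 0) _ => z z0; exact: sol_initial_lift.
move=> t0 z0 _ _ nz0.
(* The explicit solution is defined for all real times, so a single lift serves at every point and
   extends across t = 0. *)
exists [set pt : V | pt.2 != 0], (sol u0 v0).
have oU : open [set pt : V | pt.2 != 0].
  by apply: (open_comp _ (@open_punctured R 1)) => pt _; exact: cvg_snd.
split=> //; first exact: sol_smooth.
move=> t z /= nz _ _; split; first exact: hf.
rewrite (tau_plus_slice oU _ (@sol_smooth _ _ _ _ o0 _)) //; last exact: sol_neq0.
exact: sol_flow.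
Qed.

Lemma flow_limit (f : R -> torus alpha -> hopf_surface alpha) :
  dbar_flow +oo%E f -> f 0 = f0 ->
  exists finf : torus alpha -> hopf_surface alpha,
    smooth_cvg (fun k => f k%:R) finf /\
    (holomorphic_map finf \/ antiholomorphic_map finf).
Proof.
move=> flow f00; have [a [b [ab ab0 cu cv]]] := sol_limit o0.
have opq := frame_orthonormal (dot_hol_anti o0) (dot_holJ_anti o0) ab.
set u := frame1 p q a b in cu opq; set v := frame2 p q a b in cv opq.
have [finf hfinf] := @hopf_map_exists R alpha 1 2 (plane_map u v)
  (fun z => plane_map_neq0 opq) (fun k z => plane_map_scale u v _ z).
exists finf; split.
  move=> z0 nz0; pose M := dot z0 z0 + 1.
  pose U := [set z : 'rV[R]_(1.*2) | z != 0] `&` [set z | dot z z < M].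
  have lift_on g w1 w2 : (forall z, z != 0 -> lifts_at g (plane_map w1 w2) z) ->
      smooth_lift_on (alpha := alpha) U g (plane_map (n := 2) w1 w2).
    by move=> h; split=> [|z [nz _]]; [exact: smooth_plane_map | exact: h].
  exists U, (fun k => plane_map (frame_u k%:R) (frame_v k%:R)), (plane_map u v).
  split.
  - apply: openI; first exact: open_punctured.
    have -> : [set z : 'rV[R]_(1.*2) | dot z z < M] = (fun z => dot z z) @^-1` [set x | x < M].
      by [].
    apply: open_comp; last exact: open_lt.
    by move=> z _; apply: continuous_dot; exact: cvg_id.
  - by split=> //=; rewrite ltrDl.
  - exact: lift_on.
  - near=> k; apply: lift_on => z nz.
    by apply: flow_explicit flow f00 _ _ nz => //; rewrite ltry.
  - move=> ws; apply: (@iter_plane_map_uniform_cvg R 2 U _ _ u v M ws cu cv).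
    move=> z [_ /= zM].
    (* This turns the bound M on |z|^2 into the bound M on the coordinates, through M <= M^2. *)
    have M1 : 1 <= M by rewrite lerDr dot_ge0.
    have bd i : z 0 i ^+ 2 <= dot z z -> `|z 0 i| <= M.
      move=> h; rewrite -(ler_pXn2r (_ : 0 < 2)%N) ?nnegrE // ?(le_trans ler01) //.
      rewrite real_normK ?num_real // (le_trans h) // (le_trans (ltW zM)) //.
      by rewrite expr2 ler_peMr // (le_trans ler01).
    by split; apply: bd; rewrite dot_plane -!expr2 ?lerDl ?lerDr sqr_ge0.
have smooth_lift : smooth_lift_on (alpha := alpha) [set z | z != 0] finf (plane_map u v).
  by split=> [|z nz]; [exact: smooth_plane_map | exact: hfinf].
(* When a = 0 only the antilinear part is left, when b = 0 only the linear one. *)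
case: ab0 => [a0|b0]; [right | left] => z0 nz0;
  exists [set z | z != 0], (plane_map u v); split=> //; try exact: open_punctured;
  move=> z X _; rewrite !derive_plane_map.
- have -> : v = - (u *m Jmx R 2).
    by rewrite /u /v frame1J /frame2 a0 !scale0r !add0r.
  exact: plane_map_antiholomorphic.
- have -> : v = u *m Jmx R 2.
    by rewrite /u /v frame1J /frame2 b0 !scale0r addr0 subr0.
  exact: plane_map_holomorphic.
Unshelve. all: by end_near. Qed.
End MainProof.

Theorem proposition4p1 (R : realType) (alpha : R) (halpha : 1 < alpha)
    (f0 : torus alpha -> hopf_surface alpha) (hf0 : orthonormal_family f0) :
  [/\ forall (T : \bar R) (f : R -> torus alpha -> hopf_surface alpha),
        dbar_flow T f -> f 0 = f0 ->
        forall t : R, 0 <= t -> (t%:E < T)%E -> orthonormal_family (f t),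
      exists f : R -> torus alpha -> hopf_surface alpha,
        dbar_flow +oo%E f /\ f 0 = f0
    & forall f : R -> torus alpha -> hopf_surface alpha,
        dbar_flow +oo%E f -> f 0 = f0 ->
        exists (ts : nat -> R) (finf : torus alpha -> hopf_surface alpha),
          [/\ ts k @[k --> \oo] --> +oo,
              smooth_cvg (fun k => f (ts k)) finf
            & holomorphic_map finf \/ antiholomorphic_map finf]].
Proof.
have [u [v [uu vv uv f0E]]] := hf0; have o0 : orthonormal_pair u v by [].
split.
- move=> T f flow f00 t t0 tT; have [uut vvt uvt] := frame_pair o0 t.
  exists (frame1 (hol_part u v) (anti_part u v) (solA u v t) (solB u v t)),
    (frame2 (hol_part u v) (anti_part u v) (solA u v t) (solB u v t)).
  split=> // z z0.
  exact: (flow_explicit halpha o0 f0E flow f00 t0 tT z0).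
- exact: (flow_exists o0 f0E).
- move=> f flow f00; have [finf [hc hh]] := flow_limit halpha o0 f0E flow f00.
  by exists (fun k => k%:R), finf; split=> //; exact: cvgr_idn.
Qed.
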